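(* There exists a constant $C>0$, independent of all data, such that the following holds. Let $\Omega_1,\Omega_2$ be quadrature domains contained in the unit disk $\mathbb{D}\subset\mathbb{C}$ and possessing the same nodes, let $P(z)$ be the monic polynomial of degree $d$ vanishing at the common nodes, and let $Q_j(z,\overline{z})$ be the defining polynomial of $\Omega_j$, $j=1,2$. If $\|\chi_{\Omega_1}-\chi_{\Omega_2}\|_1\le\frac{C}{4d}$, then $$\sup_{|z|<2}|Q_1(z,\overline{z})-Q_2(z,\overline{z})|\le 4C\,3^{2d}\,\Bigl|\int_{\mathbb{D}}Q_1(u,\overline{u})\,(\chi_{\Omega_1}-\chi_{\Omega_2})(u)\,dA(u)\Bigr|^{\frac{1}{2d+1}}.$$
   Context: $dA$ is Lebesgue area measure, $\chi_\Omega$ is the characteristic function of $\Omega$, and $\|h\|_1=\int_{\mathbb{D}}|h|\,dA$. A quadrature domain is a bounded open set $\Omega\subset\mathbb{C}$ for which there are nodes $a_1,\dots,a_d\in\Omega$ and weights $c_1,\dots,c_d>0$ with $$\int_\Omega f\,dA=c_1f(a_1)+\dots+c_df(a_d)$$ for all complex analytic functions $f$ integrable on $\Omega$; nodes of higher multiplicity, i.e. terms involving derivatives of $f$ at the nodes, are also permitted. The number $d$ (nodes counted with multiplicity) is the order of $\Omega$. ''The same nodes'' means the same nodes with the same multiplicities; $P$ vanishes at them with these multiplicities, so that both domains have order $d=\deg P$. The defining polynomial of a quadrature domain $\Omega$ of order $d$ is the irreducible polynomial $$Q(z,\overline{z})=|P_d(z)|^2-|P_{d-1}(z)|^2-\dots-|P_1(z)|^2-|P_0(z)|^2,$$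 with $P_j\in\mathbb{C}[z]$, $\deg P_j=j$, and $P_d$ monic with zeros exactly the nodes of $\Omega$ (counted with multiplicity), such that $\Omega=\{z\in\mathbb{C}: Q(z,\overline{z})<0\}$ modulo a finite set. It is characterized by the identity $$\exp\Bigl[\frac{-1}{\pi}\int_\Omega\frac{dA(\zeta)}{(\zeta-z)(\overline{\zeta}-\overline{w})}\Bigr]=\frac{Q(z,\overline{w})}{P_d(z)\overline{P_d(w)}}$$ for $|z|,|w|$ sufficiently large, where $Q(z,\overline{w})$ denotes the polarization of $Q(z,\overline{z})$. *)

(* Defs.v *)
From HB Require Import structures.
From mathcomp Require Import all_boot all_order all_algebra polyXY.
From mathcomp Require Import all_classical all_reals all_analysis.
From mathcomp Require Import complex.
Set Implicit Arguments.
Unset Strict Implicit.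
Unset Printing Implicit Defensive.
Import Order.TTheory GRing.Theory Num.Theory.
Import numFieldNormedType.Exports ComplexField.Normc.
Local Open Scope classical_set_scope.
Local Open Scope ring_scope.
Local Open Scope complex_scope.

(* MathComp-Analysis provides neither measure theory on R[i] nor integrals of
   complex-valued functions: subsets of R[i] are pulled back to R * R, and the
   real and imaginary parts are integrated separately. *)

Definition to_complex (R : realType) (p : R * R) : R[i] := p.1 +i* p.2.

Definition area (R : realType) :
    {measure set (measurableTypeR R * measurableTypeR R) -> \bar R} :=
  (@lebesgue_measure R \x @lebesgue_measure R)%E.

Definition cintegrable (R : realType) (D : set R[i]) (f : R[i] -> R[i]) : Prop :=
  (@area R).-integrable (@to_complex R @^-1` D)
    (fun p => (complex.Re (f (to_complex p)))%:E) /\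
  (@area R).-integrable (@to_complex R @^-1` D)
    (fun p => (complex.Im (f (to_complex p)))%:E).

Definition cintegral (R : realType) (D : set R[i]) (f : R[i] -> R[i]) : R[i] :=
  (\int[@area R]_(p in @to_complex R @^-1` D) complex.Re (f (to_complex p)))%R +i*
  (\int[@area R]_(p in @to_complex R @^-1` D) complex.Im (f (to_complex p)))%R.

Definition norm1 (R : realType) (D : set R[i]) (h : R[i] -> R) : \bar R :=
  (\int[@area R]_(p in @to_complex R @^-1` D) (`|h (to_complex p)|)%:E)%E.

Definition disk (R : realType) (r : R) : set R[i] := [set z | normc z < r].

Definition cexp (R : realType) (z : R[i]) : R[i] :=
  (expR (complex.Re z))%:C * (cos (complex.Im z) +i* sin (complex.Im z)).

(* R[i]^o carries the norm topology of C and is a normed space over C itself,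
   so [derivable f z 1] is complex differentiability and [derive1n k f] the k-th
   complex derivative. *)
Definition analytic_on (R : realType) (D : set R[i]) (f : R[i] -> R[i]) : Prop :=
  forall z, D z -> derivable (f : R[i]^o -> R[i]^o) z 1.

(* The nodes are listed with repetition, so the multiplicity of x is
   [count_mem x a] and the order of the domain is [size a]. A node of
   multiplicity m contributes the derivatives of f at that node of order < m,
   with complex coefficients, the one of order m.-1 being nonzero; the weight of
   a simple node is real and positive (which is what 0 < _ means in R[i]). *)
Definition quadrature_domain (R : realType) (a : seq R[i]) (Omega : set R[i])
    : Prop :=
  [/\ (0 < size a)%N,
      open (Omega : set R[i]^o),
      bounded_set (Omega : set R[i]^o),
      {in a, forall x, Omega x} &
      exists c : R[i] -> nat -> R[i],
        [/\ {in a, forall x, c x (count_mem x a).-1 != 0},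
            {in a, forall x, count_mem x a = 1%N -> 0 < c x 0%N} &
            forall f : R[i] -> R[i],
              analytic_on Omega f -> cintegrable Omega f ->
              cintegral Omega f =
                \sum_(x <- undup a) \sum_(k < count_mem x a)
                  c x k * derive1n k (f : R[i] -> R[i]^o) x]].

(* A polynomial Q(z, w) in two variables is a {poly {poly R[i]}} evaluated as
   Q.[z, w]; the polynomial written Q(z, \bar w) is Q.[z, w^*]. *)
Definition polarized (R : realType) (Q : {poly {poly R[i]}}) (z w : R[i]) : R[i] :=
  Q.[z, w^*%R].

(* The polynomial whose polarized value is p(z) (p(w))^*. *)
Definition poly_sqr_norm (R : realType) (p : {poly R[i]}) : {poly {poly R[i]}} :=
  map_poly polyC p * (map_poly (fun c : R[i] => c^*%R) p)%:P.

Definition irreducible_elt (A : unitRingType) (x : A) : Prop :=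
  [/\ x != 0, x \isn't a GRing.unit &
      forall y z : A, x = y * z -> (y \is a GRing.unit) || (z \is a GRing.unit)].

(* P is the monic polynomial whose zeros are the nodes of Omega. *)
Definition defining_polynomial (R : realType) (P : {poly R[i]})
    (Omega : set R[i]) (Q : {poly {poly R[i]}}) : Prop :=
  let d := (size P).-1 in
  [/\ irreducible_elt Q,
      exists p : nat -> {poly R[i]},
        [/\ forall j, (j <= d)%N -> size (p j) = j.+1,
            p d = P &
            Q = poly_sqr_norm (p d) - \sum_(j < d) poly_sqr_norm (p j)],
      let N := [set z : R[i] | polarized Q z z < 0] in
      finite_set ((Omega `\` N) `|` (N `\` Omega)) &
      exists M : R, forall z w : R[i], M < normc z -> M < normc w ->
        cexp (- (pi^-1)%:C *
              cintegral Omega (fun u => ((u - z) * (u^*%R - w^*%R))^-1)) =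
        polarized Q z w / (P.[z] * (P.[w])^*%R)].

(* Main.v *)
Require Import Defs.
From HB Require Import structures.
From mathcomp Require Import all_boot all_order all_algebra polyXY.
From mathcomp Require Import all_classical all_reals all_analysis.
From mathcomp Require Import measurable_realfun.
From mathcomp Require Import cyclic separable cyclotomic complex.
From mathcomp Require Import ring lra zify.

(** Let m be the area of the symmetric difference of the two domains, and I the
    integral of Q_1 against the difference of their characteristic functions. The
    theorem combines two independent estimates.

    Stability: |Q_1 - Q_2| <= 2 e^8 3^(2d) m on the disk of radius 2
    ([defining_polynomial_stable]). With s = 1/z and t = 1/(conj w), the exponential
    identity reads Q_j = P(z) (conj P(w)) exp(- A_j(s, t)) near infinity, where A_j is
    a double power series whose coefficients are, up to 1/pi, the moments of the j-th
    domain. Measure such series by the sum of the moduli of their coefficients with the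
    weights 2^(-k-l), a submultiplicative norm ([wiener_norm]). In it A_1 and A_2 have
    norm at most 8 and A_1 - A_2 at most 2m, so exp(-A_1) - exp(-A_2) has norm at most
    2 e^8 m. Multiply by the product of the (1 - a s)(1 - (conj a) t) over the nodes a,
    whose norm is at most (3/2)^(2d): the result is Q_1 - Q_2 with its coefficients
    reversed, and undoing the reversal costs 4^d on |z|, |w| <= 2
    ([transfer_estimate]). Infinite series are avoided by replacing exp(- A) with
    (1 - p/n)^n, p a partial sum of A ([exp_transform_approx]), and coefficients are
    compared by Cauchy's estimate on a small torus ([cauchy_estimate2]).

    Area: m <= 17 |I|^(1/(2d+1)) ([diff_area_le_root]). Up to finitely many points Q_1
    is negative exactly on the first domain, so |I| is at least the integral of |Q_1|
    over the symmetric difference. On a vertical line Q_1 is a monic polynomial of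
    degree 2d, so by Polya's bound ([polya_sublevel]) the part of the disk where
    |Q_1| <= delta^(2d) has area at most 16 delta, with a constant independent of d
    ([sublevel_area]). Hence m <= 16 delta + |I| / delta^(2d), and
    delta = |I|^(1/(2d+1)) gives the claim. *)

Import Order.TTheory GRing.Theory Num.Theory.
Import numFieldNormedType.Exports ComplexField.Normc.
Set Implicit Arguments.
Unset Strict Implicit.
Unset Printing Implicit Defensive.
Local Open Scope classical_set_scope.
Local Open Scope ring_scope.
Local Open Scope complex_scope.

(** * Weighted absolute coefficient norms on polynomials *)

Section ring_norm.
Variable R : realFieldType.

(** Only [N 1 <= 1] is asked, and [N] may vanish outside 0: the single notion
    covers [normc] on R[i] and the norms [wiener] that it induces on polynomials
    in one and in two variables. *)
Record ring_norm (A : nzRingType) (N : A -> R) : Prop := RingNorm {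
  rnorm0 : N 0 = 0;
  rnorm1 : N 1 <= 1;
  rnorm_ge0 : forall x, 0 <= N x;
  rnormN : forall x, N (- x) = N x;
  rnormD : forall x y, N (x + y) <= N x + N y;
  rnormM : forall x y, N (x * y) <= N x * N y }.

Lemma rnorm_sum (A : nzRingType) (N : A -> R) (I : Type) (r : seq I)
    (Q : pred I) (F : I -> A) :
  ring_norm N -> N (\sum_(i <- r | Q i) F i) <= \sum_(i <- r | Q i) N (F i).
Proof.
move=> HN; elim/big_ind2: _ => [|x y z t xy zt|//]; first by rewrite rnorm0.
exact: le_trans (rnormD HN _ _) (lerD xy zt).
Qed.

Lemma rnorm_prod (A : nzRingType) (N : A -> R) (I : eqType) (r : seq I)
    (F : I -> A) (K : R) :
  ring_norm N -> {in r, forall i, N (F i) <= K} ->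
  N (\prod_(i <- r) F i) <= K ^+ size r.
Proof.
move=> HN; elim: r => [|i r IH] H; first by rewrite big_nil expr0 rnorm1.
rewrite big_cons exprS (le_trans (rnormM HN _ _))//.
apply: ler_pM; rewrite ?rnorm_ge0 ?H ?mem_head//.
by apply: IH => j jr; apply: H; rewrite inE jr orbT.
Qed.

Lemma rnormX (A : nzRingType) (N : A -> R) (x : A) (K : R) n :
  ring_norm N -> N x <= K -> N (x ^+ n) <= K ^+ n.
Proof.
move=> HN xK; elim: n => [|n IH]; first by rewrite !expr0 rnorm1.
by rewrite !exprS (le_trans (rnormM HN _ _))// ler_pM ?rnorm_ge0.
Qed.

(** Factor [x ^+ n.+1 - y ^+ n.+1] by [x - y]: each of the [n.+1] terms of the
    cofactor has norm at most [K ^+ n]. This is the form in which the exponential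
    is seen to be Lipschitz, an exponential being a high power of something close
    to 1. *)
Lemma rnorm_subX (A : comNzRingType) (N : A -> R) (x y : A) (K : R) n :
  ring_norm N -> N x <= K -> N y <= K ->
  N (x ^+ n.+1 - y ^+ n.+1) <= N (x - y) * K ^+ n *+ n.+1.
Proof.
move=> HN xK yK; rewrite subrXX (le_trans (rnormM HN _ _))// -mulrnAr.
rewrite ler_wpM2l ?rnorm_ge0// (le_trans (rnorm_sum _ _ _ HN))//.
rewrite -[in leRHS](card_ord n.+1) -sumr_const.
apply: ler_sum => i _; rewrite (le_trans (rnormM HN _ _))//.
rewrite [leRHS](_ : _ = K ^+ (n - i) * K ^+ i); last first.
  by rewrite -exprD subnK// -ltnS.
by apply: ler_pM; rewrite ?rnorm_ge0 ?rnormX.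
Qed.

Definition norm_poly (A : nzRingType) (N : A -> R) (p : {poly A}) : {poly R} :=
  \poly_(i < size p) N p`_i.

(** The weighted l1 norm of the coefficients, presented as the value at [rho] of
    the polynomial of the norms so that [hornerM] gives submultiplicativity. *)
Definition wiener (A : nzRingType) (N : A -> R) (rho : R) (p : {poly A}) : R :=
  (norm_poly N p).[rho].

Section wiener.
Variables (A : nzRingType) (N : A -> R) (rho : R).
Hypotheses (HN : ring_norm N) (rho0 : 0 <= rho).

Lemma coef_norm_poly (p : {poly A}) i : (norm_poly N p)`_i = N p`_i.
Proof.
by rewrite coef_poly; case: ltnP => // h; rewrite nth_default ?rnorm0.
Qed.

Lemma wiener_wide n (p : {poly A}) : (size p <= n)%N ->
  wiener N rho p = \sum_(i < n) N p`_i * rho ^+ i.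
Proof.
move=> pn; rewrite /wiener (@horner_coef_wide _ n); last first.
  exact: leq_trans (size_poly _ _) pn.
by apply: eq_bigr => i _; rewrite coef_norm_poly.
Qed.

Lemma wienerC a : wiener N rho a%:P = N a.
Proof.
rewrite (@wiener_wide 1) ?size_polyC ?leq_b1//.
by rewrite big_ord1 coefC eqxx expr0 mulr1.
Qed.

(** Submultiplicativity is the comparison of [p * q] with its majorant
    [norm_poly N p * norm_poly N q]. Since the result is again a [ring_norm], the
    construction iterates to several variables. *)
Lemma wiener_norm : ring_norm (wiener N rho).
Proof.
split.
- by rewrite (@wiener_wide 0) ?size_poly0// big_ord0.
- by rewrite wienerC rnorm1.
- move=> p; rewrite (@wiener_wide (size p))//; apply: sumr_ge0 => i _.
  by rewrite mulr_ge0 ?exprn_ge0 ?rnorm_ge0.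
- move=> p; rewrite (@wiener_wide (size p)) ?size_polyN// (@wiener_wide (size p))//.
  by apply: eq_bigr => i _; rewrite coefN rnormN.
- move=> p q; set n := maxn (size p) (size q).
  rewrite !(@wiener_wide n) ?leq_maxl ?leq_maxr//; last first.
    by rewrite (leq_trans (size_polyD _ _)).
  rewrite -big_split/=; apply: ler_sum => i _.
  by rewrite coefD -mulrDl ler_wpM2r ?exprn_ge0// rnormD.
- move=> p q; rewrite {2 3}/wiener -hornerM.
  set n := maxn (size (p * q)) (size (norm_poly N p * norm_poly N q)).
  rewrite (@wiener_wide n) ?leq_maxl// (@horner_coef_wide _ n) ?leq_maxr//.
  apply: ler_sum => i _; rewrite ler_wpM2r ?exprn_ge0// !coefM.
  rewrite (le_trans (rnorm_sum _ _ _ HN))//; apply: ler_sum => j _.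
  by rewrite !coef_norm_poly rnormM.
Qed.

End wiener.
End ring_norm.

(** * Moduli of complex numbers and Cauchy's estimate for polynomials *)

Section complex_norm.
Variable R : rcfType.
Implicit Types z : R[i].

(** [normcN] and [le_normcD] are stated for [Rcomplex R], whose ring structure is
    convertible to that of R[i] but is not found by unification. *)
Lemma normc_opp z : normc (- z) = normc z. Proof. exact: normcN. Qed.

Lemma normcD_le z w : normc (z + w) <= normc z + normc w.
Proof. exact: le_normcD. Qed.

Lemma normc_ge0 z : 0 <= normc z.
Proof. by case: z => a b; rewrite sqrtr_ge0. Qed.

Lemma ring_norm_normc : ring_norm (@normc R).
Proof.
split=> //; [exact: normc0|by rewrite normc1|exact: normc_ge0|exact: normc_opp| |].
  exact: normcD_le.
by move=> x y; rewrite normcM.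
Qed.

Lemma normcX z n : normc (z ^+ n) = normc z ^+ n.
Proof. by elim: n => [|n IH]; rewrite ?expr0 ?normc1// !exprS normcM IH. Qed.

Lemma normc_prod (I : Type) (r : seq I) (P : pred I) (F : I -> R[i]) :
  normc (\prod_(i <- r | P i) F i) = \prod_(i <- r | P i) normc (F i).
Proof. by apply: (big_morph _ (@normcM R) (normc1 R)). Qed.

Lemma normc_sum (I : Type) (r : seq I) (P : pred I) (F : I -> R[i]) :
  normc (\sum_(i <- r | P i) F i) <= \sum_(i <- r | P i) normc (F i).
Proof. exact: rnorm_sum ring_norm_normc. Qed.

Lemma normc_real (x : R) : normc x%:C = `|x|.
Proof. by rewrite /= expr0n addr0 sqrtr_sqr. Qed.

Lemma normc_nat n : normc (n%:R : R[i]) = n%:R.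
Proof.
have -> : (n%:R : R[i]) = (n%:R : R)%:C by rewrite rmorph_nat.
by rewrite normc_real ger0_norm.
Qed.

Lemma normc_conj z : normc z^*%R = normc z.
Proof. by case: z => a b; rewrite /= sqrrN. Qed.

Lemma normcB_ge z w : normc z - normc w <= normc (z - w).
Proof. by rewrite lerBlDr -{1}(subrK w z) normcD_le. Qed.

Lemma normc_Re z : `|complex.Re z| <= normc z.
Proof. by case: z => a b /=; rewrite -sqrtr_sqr ler_wsqrtr// lerDl sqr_ge0. Qed.

Lemma normc_Im z : `|complex.Im z| <= normc z.
Proof. by case: z => a b /=; rewrite -sqrtr_sqr ler_wsqrtr// lerDr sqr_ge0. Qed.

Lemma normc_le_ReIm z : normc z <= `|complex.Re z| + `|complex.Im z|.
Proof.
have i1 : normc ('i%C : R[i]) = 1 by rewrite /= expr0n/= add0r expr1n sqrtr1.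
by rewrite {1}[z]complexE (le_trans (normcD_le _ _))// normcM !normc_real i1 mul1r.
Qed.

Lemma complex_prim_root n : (0 < n)%N -> exists w : R[i], n.-primitive_root w.
Proof.
move=> n0; pose p : {poly R[i]} := 'X^n - 1.
have [r Dp] := closed_field_poly_normal p.
rewrite (monicP _) ?monicXnsubC // scale1r in Dp.
have rn1 : all n.-unity_root r by apply/allP=> z; rewrite -root_prod_XsubC -Dp.
have sz_r : (n < (size r).+1)%N by rewrite -(size_prod_XsubC r id) -Dp size_XnsubC.
have [|z] := hasP (has_prim_root n0 rn1 _ sz_r); last by exists z.
by rewrite -separable_prod_XsubC -Dp separable_Xn_sub_1 // pnatr_eq0 -lt0n.
Qed.

(** The mean of [p.[z] / z ^+ k] over the circle of radius [r] is the coefficient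
    of index [k]. For a polynomial of size [n] the mean over the [n]-th roots of
    unity already has this value, so that no contour integral is needed. *)
Lemma cauchy_estimate (p : {poly R[i]}) (r B : R) k : 0 < r ->
  (forall z, normc z = r -> normc p.[z] <= B) -> normc p`_k * r ^+ k <= B.
Proof.
move=> r0 pB.
have B0 : 0 <= B.
  by rewrite (le_trans (normc_ge0 p.[r%:C])) ?pB// normc_real ger0_norm ?ltW.
have [kp|kp] := leqP (size p) k.
  by rewrite nth_default// normc0 mul0r.
set n := size p.
have n0 : (0 < n)%N by apply: leq_trans kp.
have [w wn] := complex_prim_root n0.
have w1 : normc w = 1.
  have /eqP := prim_expr_order wn; move=> /eqP/(congr1 (@normc R)).
  rewrite normcX normc1 => /eqP.
  by rewrite pexpr_eq1 ?normc_ge0// => /eqP.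
(* [w ^+ (j * (n - k))] plays the role of [w ^- (j * k)]. *)
have key : \sum_(j < n) p.[r%:C * w ^+ j] * w ^+ (j * (n - k)) =
    n%:R * (p`_k * r%:C ^+ k).
  under eq_bigr do rewrite horner_coef mulr_suml.
  rewrite exchange_big/= (bigD1 (Ordinal kp))//= [X in _ + X]big1 ?addr0.
    rewrite mulrC -[n in _ *+ n]card_ord mulr_natr -sumr_const.
    apply: eq_bigr => j _; rewrite exprMn -!mulrA -exprM -exprD -mulnDr.
    by rewrite subnKC ?(ltnW kp)// mulnC exprM (prim_expr_order wn) expr1n mulr1.
  move=> i ik.
  rewrite (eq_bigr (fun j : 'I_n => p`_i * r%:C ^+ i * (w ^+ (i + (n - k))) ^+ j)); last first.
    move=> j _; rewrite exprMn -!mulrA; congr (_ * (_ * _)).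
    by rewrite -!exprM -exprD mulnDl (mulnC i) (mulnC (n - k)%N).
  rewrite -mulr_sumr; set v := w ^+ _.
  have v1 : v != 1.
    rewrite /v -(prim_order_dvd wn); apply: contra ik => /dvdnP[c hc].
    apply/eqP/val_inj => /=.
    have := ltn_ord i; move: hc kp; rewrite -/n => hc kn iltn.
    have : (c * n < 2 * n)%N by rewrite -hc; lia.
    rewrite ltn_mul2r n0/=; case: c hc => [|[|//]] hc _; lia.
  have : (v - 1) * (\sum_(j < n) v ^+ j) = 0.
    rewrite -subrX1 /v -exprM mulnC exprM (prim_expr_order wn) expr1n subrr//.
  by move/eqP; rewrite mulf_eq0 subr_eq0 (negbTE v1)/= => /eqP ->; rewrite mulr0.
have : normc (n%:R * (p`_k * r%:C ^+ k)) <= n%:R * B.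
  rewrite -key (le_trans (normc_sum _ _ _))//.
  rewrite -[X in _ <= X%:R * _]card_ord mulr_natl -sumr_const.
  apply: ler_sum => j _; rewrite normcM normcX w1 expr1n mulr1 pB//.
  by rewrite normcM normcX w1 expr1n mulr1 normc_real ger0_norm// ltW.
rewrite !normcM normcX normc_nat normc_real (ger0_norm (ltW r0)).
by rewrite ler_pM2l// ltr0n.
Qed.

Lemma cauchy_estimate2 (p : {poly {poly R[i]}}) (r B : R) k l : 0 < r ->
  (forall z w, normc z = r -> normc w = r -> normc p.[z, w] <= B) ->
  normc p`_k`_l * r ^+ (k + l) <= B.
Proof.
move=> r0 pB; rewrite addnC exprD mulrA -ler_pdivlMr ?exprn_gt0//.
apply: cauchy_estimate => // w wr.
rewrite ler_pdivlMr ?exprn_gt0//.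
have -> : (p`_k).[w] = (map_poly (horner_eval w) p)`_k.
  by rewrite coef_map/= ?horner_evalE// /horner_eval horner0.
apply: cauchy_estimate => // z zr.
have := pB z w zr wr.
suff -> : p.[z, w] = (map_poly (horner_eval w) p).[z] by [].
rewrite (_ : z = horner_eval w z%:P); last by rewrite /horner_eval hornerC.
by rewrite horner_map /= /horner_eval hornerC.
Qed.

End complex_norm.

(** * The complex exponential *)

Section complex_exponential.
Variable R : realType.
Implicit Types (x y : R) (z w : R[i]).

Lemma MVT_norm (f df : R -> R) (K y : R) :
  (forall x, is_derive x 1 f (df x)) -> (forall x, `|x| <= `|y| -> `|df x| <= K) ->
  `|f y - f 0| <= K * `|y|.
Proof.
move=> fdf dfK.
have cf a b : {within `[a, b], continuous f}.
  apply: continuous_subspaceT => x.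
  by apply: differentiable_continuous; apply/derivable1_diffP; have [] := fdf x.
have [y0|y0] := leP 0 y.
  have [c] := MVT_segment y0 (fun x _ => fdf x) (cf _ _).
  rewrite in_itv/= => /andP[c0 cy] ->; rewrite subr0 normrM ler_wpM2r//.
  by rewrite dfK// !ger0_norm.
have [c] := MVT_segment (ltW y0) (fun x _ => fdf x) (cf _ _).
rewrite in_itv/= => /andP[c0 cy] h; rewrite distrC h sub0r normrM normrN ler_wpM2r//.
by rewrite dfK// !ler0_norm// ?lerN2// ltW.
Qed.

Lemma abs_sin_le y : `|sin y| <= `|y|.
Proof.
have := @MVT_norm sin cos 1 y (fun x => is_derive_sin x) (fun x _ => cos_max x).
by rewrite sin0 subr0 mul1r.
Qed.

Lemma abs_cosB1_le y : `|cos y - 1| <= y ^+ 2.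
Proof.
have := @MVT_norm cos (fun x => - sin x) `|y| y (fun x => is_derive_cos x).
rewrite cos0 -expr2 real_normK ?num_real//; apply=> x xy.
by rewrite normrN (le_trans (abs_sin_le x)).
Qed.

Lemma abs_sinB_le y : `|y| <= 1 -> `|sin y - y| <= y ^+ 2.
Proof.
move=> y1.
have := @MVT_norm (fun x => sin x - x) (fun x => cos x - 1) (y ^+ 2) y.
rewrite sin0 !subr0 => h.
rewrite (le_trans (h _ _))//; last by rewrite ler_piMr ?sqr_ge0.
by move=> x xy; rewrite (le_trans (abs_cosB1_le x))// -real_normK ?num_real//
  -[leRHS]real_normK ?num_real// lerXn2r ?nnegrE.
Qed.

(** The upper bound comes from [1 - x <= expR (- x)], that is
    [expR x <= (1 - x)^-1], and [(1 - x)^-1 <= 1 + x + 2 * x ^+ 2] for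
    [x <= 1/2]. *)
Lemma abs_expRB_le x : `|x| <= 2^-1 -> `|expR x - 1 - x| <= 2 * x ^+ 2.
Proof.
move=> /ler_normlP[x1 x2].
have h1 := expR_ge1Dx x; have h2 := expR_ge1Dx (- x).
rewrite ger0_norm; last by rewrite -addrA -opprD subr_ge0.
have e0 := expR_gt0 x.
have : expR x * (1 - x) <= 1.
  by rewrite -[leRHS](expRxMexpNx_1 x) ler_pM2l.
move=> h3; rewrite -(ler_pM2r (_ : 0 < 1 - x)); last by lra.
have : 0 <= x ^+ 2 * (1 - 2 * x) by rewrite mulr_ge0 ?sqr_ge0//; lra.
by nra.
Qed.

Lemma cexpD z w : cexp (z + w) = cexp z * cexp w.
Proof.
case: z w => [a b] [c d]; rewrite /cexp/= expRD cosD sinD.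
by apply/eqP; rewrite eq_complex/=; apply/andP; split; apply/eqP; ring.
Qed.

(** [cexp] is only evaluated as [cexp (z / n) ^+ n] with a large [n], so that the
    first-order expansion [cexp_taylor1] is all that is needed of it. *)
Lemma cexpMn z n : cexp (z *+ n) = cexp z ^+ n.
Proof.
elim: n => [|n IH]; last by rewrite mulrS cexpD IH exprS.
by rewrite mulr0n expr0 /cexp/= expR0 cos0 sin0 mul1r.
Qed.

Lemma normc_cexp z : normc (cexp z) = expR (complex.Re z).
Proof.
rewrite /cexp normcM normc_real ger0_norm ?expR_ge0//=.
by rewrite cos2Dsin2 sqrtr1 mulr1.
Qed.

Lemma normc_cexp_le z : normc (cexp z) <= expR (normc z).
Proof.
by rewrite normc_cexp ler_expR (le_trans (ler_norm _))// normc_Re.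
Qed.

Lemma cexp_taylor1 z : normc z <= 2^-1 ->
  normc (cexp z - 1 - z) <= 10 * normc z ^+ 2.
Proof.
case: z => x y z1.
have yN := normc_Im (x +i* y); have xN := normc_Re (x +i* y).
move: (normc (x +i* y)) z1 yN xN => N z1; rewrite [complex.Im _]/= [complex.Re _]/= => yN xN.
have N0 : 0 <= N by apply: le_trans xN.
rewrite (le_trans (normc_le_ReIm _))//=.
have x2 : `|x| <= 2^-1 by apply: le_trans z1.
have y1 : `|y| <= 1 by apply: (le_trans yN); lra.
have /ler_normlP[e1 e2] := abs_expRB_le x2.
have /ler_normlP[c1 c2] := abs_cosB1_le y.
have /ler_normlP[s1 s2] := abs_sinB_le y1.
have xx : x ^+ 2 <= N ^+ 2 by rewrite -real_normK ?num_real// lerXn2r ?nnegrE.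
have yy : y ^+ 2 <= N ^+ 2 by rewrite -real_normK ?num_real// lerXn2r ?nnegrE.
have ex2 : expR x <= 2 by move: x2 => /ler_normlP[? ?]; nra.
have e0 := expR_gt0 x.
rewrite !(mul0r, subr0, mulr0, addr0, add0r, oppr0).
apply: (@le_trans _ _ (4 * N ^+ 2 + 6 * N ^+ 2)); last by rewrite -mulrDl; nra.
apply: lerD.
  have -> : expR x * cos y - 1 - x = (expR x - 1 - x) + expR x * (cos y - 1) by ring.
  rewrite (le_trans (ler_normD _ _))// normrM (ger0_norm (ltW e0)).
  have : `|expR x - 1 - x| <= 2 * N ^+ 2.
    by rewrite (le_trans (abs_expRB_le x2))// ler_pM2l.
  have : expR x * `|cos y - 1| <= 2 * N ^+ 2.
    by rewrite ler_pM ?(ltW e0)// (le_trans (abs_cosB1_le y)).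
  by lra.
have -> : expR x * sin y - y = expR x * (sin y - y) + (expR x - 1) * y by ring.
rewrite (le_trans (ler_normD _ _))// !normrM (ger0_norm (ltW e0)).
have : expR x * `|sin y - y| <= 2 * N ^+ 2.
  by rewrite ler_pM ?(ltW e0)// (le_trans (abs_sinB_le y1)).
have ex1 : `|expR x - 1| <= 2 * N.
  have -> : expR x - 1 = (expR x - 1 - x) + x by ring.
  rewrite (le_trans (ler_normD _ _))//.
  have : `|expR x - 1 - x| <= 2 * N ^+ 2.
    by rewrite (le_trans (abs_expRB_le x2))// ler_pM2l.
  by move=> h; nra.
have : `|expR x - 1| * `|y| <= (2 * N) * N by rewrite ler_pM.
by nra.
Qed.

End complex_exponential.

(** * Measurability in the plane *)

Section plane_measurability.
Variable R : realType.
Local Notation plane := (measurableTypeR R * measurableTypeR R)%type.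
Local Notation toC := (@to_complex R).
Implicit Types f g : R[i] -> R[i].

Definition cmeasurable f : Prop :=
  measurable_fun setT (fun p : plane => complex.Re (f (toC p))) /\
  measurable_fun setT (fun p : plane => complex.Im (f (toC p))).

Lemma ReD (z w : R[i]) : complex.Re (z + w) = complex.Re z + complex.Re w.
Proof. by case: z w => [a b] [c d]. Qed.

Lemma ImD (z w : R[i]) : complex.Im (z + w) = complex.Im z + complex.Im w.
Proof. by case: z w => [a b] [c d]. Qed.

Lemma ReM (z w : R[i]) :
  complex.Re (z * w) = complex.Re z * complex.Re w - complex.Im z * complex.Im w.
Proof. by case: z w => [a b] [c d]. Qed.

Lemma ImM (z w : R[i]) :
  complex.Im (z * w) = complex.Re z * complex.Im w + complex.Im z * complex.Re w.
Proof. by case: z w => [a b] [c d]. Qed.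

Lemma ReN (z : R[i]) : complex.Re (- z) = - complex.Re z.
Proof. by case: z. Qed.

Lemma ImN (z : R[i]) : complex.Im (- z) = - complex.Im z.
Proof. by case: z. Qed.

Lemma cmeasurable_cst c : cmeasurable (fun=> c).
Proof. by split; apply: measurable_cst. Qed.

Lemma cmeasurable_id : cmeasurable id.
Proof. by split => /=; [exact: measurable_fst|exact: measurable_snd]. Qed.

Lemma cmeasurableD f g :
  cmeasurable f -> cmeasurable g -> cmeasurable (fun u => f u + g u).
Proof.
move=> [f1 f2] [g1 g2]; split.
  by under eq_fun do rewrite ReD; exact: measurable_funD.
by under eq_fun do rewrite ImD; exact: measurable_funD.
Qed.

Lemma cmeasurableN f : cmeasurable f -> cmeasurable (fun u => - f u).
Proof.
move=> [f1 f2]; split.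
  by under eq_fun do rewrite ReN; exact: measurableT_comp.
by under eq_fun do rewrite ImN; exact: measurableT_comp.
Qed.

Lemma cmeasurableM f g :
  cmeasurable f -> cmeasurable g -> cmeasurable (fun u => f u * g u).
Proof.
move=> [f1 f2] [g1 g2]; split.
  under eq_fun do rewrite ReM.
  by apply: measurable_funB; exact: measurable_funM.
under eq_fun do rewrite ImM.
by apply: measurable_funD; exact: measurable_funM.
Qed.

Lemma cmeasurableJ f : cmeasurable f -> cmeasurable (fun u => (f u)^*%R).
Proof.
have eRe (z : R[i]) : complex.Re z^*%R = complex.Re z by case: z.
have eIm (z : R[i]) : complex.Im z^*%R = - complex.Im z by case: z.
move=> [f1 f2]; split; first by under eq_fun do rewrite eRe.
by under eq_fun do rewrite eIm; exact: measurableT_comp.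
Qed.

Lemma cmeasurableX f n : cmeasurable f -> cmeasurable (fun u => f u ^+ n).
Proof.
move=> mf; elim: n => [|n IH]; first exact: cmeasurable_cst.
by under eq_fun do rewrite exprS; exact: cmeasurableM.
Qed.

Lemma cmeasurable_sum n (F : nat -> R[i] -> R[i]) :
  (forall i, cmeasurable (F i)) -> cmeasurable (fun u => \sum_(i < n) F i u).
Proof.
move=> mF; elim: n => [|n IH].
  by under eq_fun do rewrite big_ord0; exact: cmeasurable_cst.
by under eq_fun do rewrite big_ord_recr/=; exact: cmeasurableD.
Qed.

(** The real inverse of the squared modulus is written as the power of exponent
    -1, a function whose measurability is known on the whole line; at 0 both are
    0. *)
Lemma cmeasurableV f : cmeasurable f -> cmeasurable (fun u => (f u)^-1).
Proof.
move=> [f1 f2].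
have mr : measurable_fun setT (fun p : plane =>
    (complex.Re (f (toC p)) ^+ 2 + complex.Im (f (toC p)) ^+ 2) `^ (-1)).
  apply: (measurableT_comp (measurable_powR _ )).
  by apply: measurable_funD; exact: measurable_funX.
have e (z : R[i]) : z^-1 =
    (complex.Re z * (complex.Re z ^+ 2 + complex.Im z ^+ 2) `^ (-1)) +i*
    (- complex.Im z * (complex.Re z ^+ 2 + complex.Im z ^+ 2) `^ (-1)).
  by rewrite powR_inv1 ?addr_ge0 ?sqr_ge0//; case: z => a b /=; rewrite mulNr.
split; under eq_fun do rewrite e/=; first exact: measurable_funM.
by apply: measurable_funM => //; exact: measurableT_comp.
Qed.

Lemma cmeasurable_horner2 (Q : {poly {poly R[i]}}) f g :
  cmeasurable f -> cmeasurable g -> cmeasurable (fun u => Q.[f u, g u]).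
Proof.
move=> mf mg.
have mp (p : {poly R[i]}) h : cmeasurable h -> cmeasurable (fun u => p.[h u]).
  move=> mh; under eq_fun do rewrite horner_coef.
  apply: (@cmeasurable_sum _ (fun i u => p`_i * h u ^+ i)) => i.
  by apply: cmeasurableM; [exact: cmeasurable_cst|exact: cmeasurableX].
under eq_fun do rewrite (horner_coef Q) horner_sum.
under eq_fun do under eq_bigr do rewrite hornerM -polyC_exp hornerC.
apply: (@cmeasurable_sum _ (fun i u => (Q`_i).[g u] * f u ^+ i)) => i.
by apply: cmeasurableM; [exact: mp|exact: cmeasurableX].
Qed.

Lemma cmeasurable_norm f :
  cmeasurable f -> measurable_fun setT (fun p : plane => normc (f (toC p))).
Proof.
move=> [f1 f2].
have -> : (fun p : plane => normc (f (toC p))) = (fun p : plane =>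
    Num.sqrt (complex.Re (f (toC p)) ^+ 2 + complex.Im (f (toC p)) ^+ 2)).
  by apply: funext => p; case: (f _).
apply: measurableT_comp; first by apply: continuous_measurable_fun; exact: sqrt_continuous.
by apply: measurable_funD; exact: measurable_funX.
Qed.

Lemma measurable_disk (r : R) : measurable (toC @^-1` disk r : set plane).
Proof.
have -> : toC @^-1` disk r =
    setT `&` (fun p : plane => normc (toC p)) @^-1` `]-oo, r[%classic.
  by rewrite setTI; apply/seteqP; split=> p; rewrite /disk/= in_itv.
exact: (cmeasurable_norm cmeasurable_id).
Qed.

(** The measurable sets of the plane are those of the product sigma-algebra, so an
    open set is exhibited as the countable union of the rational boxes that it
    contains. *)
Lemma measurable_open_preimage (U : set R[i]) :
  open (U : set R[i]^o) -> measurable (toC @^-1` U : set plane).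
Proof.
move=> oU; pose box (q : rat * rat * rat * rat) : set plane :=
  `]ratr q.1.1.1, ratr q.1.1.2[%classic `*` `]ratr q.1.2, ratr q.2[%classic.
have -> : toC @^-1` U =
    \bigcup_q (if `[< box q `<=` toC @^-1` U >] then box q else set0).
  apply/seteqP; split=> [[x y] /= Uxy|p [q _]]; last first.
    by case: asboolP => // sub; exact: sub.
  have /nbhs_ballP[e /= e0 eU] : nbhs (x +i* y : R[i]^o) (U : set R[i]^o).
    by move: oU; rewrite openE => /(_ _ Uxy).
  pose r := complex.Re e / 2.
  have r0 : 0 < r by move: e0; rewrite ltcE/= => /andP[_ e0]; rewrite divr_gt0.
  have er : e = (r * 2)%:C.
    move: e0; rewrite ltcE/= => /andP[/eqP e0 _]; rewrite /r divfK//.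
    by case: e e0 {eU r r0} => a b /= ->.
  have rat_near (t : R) : exists ab : rat * rat,
      [/\ t - r / 2 < ratr ab.1, ratr ab.1 < t, t < ratr ab.2 & ratr ab.2 < t + r / 2].
    have h1 : t - r / 2 < t by rewrite ltrBlDr ltrDl divr_gt0.
    have h2 : t < t + r / 2 by rewrite ltrDl divr_gt0.
    have [a] := rat_in_itvoo h1; rewrite in_itv/= => /andP[a1 a2].
    have [b] := rat_in_itvoo h2; rewrite in_itv/= => /andP[b1 b2].
    by exists (a, b).
  have [[a b] /= [a1 a2 b1 b2]] := rat_near x.
  have [[c d] /= [c1 c2 d1 d2]] := rat_near y.
  exists (a, b, c, d) => //; rewrite asboolT.
    by split; rewrite /= in_itv/=; apply/andP.
  move=> [x' y'] []; rewrite /= !in_itv/= => /andP[x1 x2] /andP[y1 y2].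
  apply: eU; rewrite /ball/= er.
  rewrite (_ : `|_| = (normc ((x +i* y) - (x' +i* y')))%:C)//.
  rewrite ltcR (le_lt_trans (normc_le_ReIm _))//=.
  have h1 : `|x - x'| < r by rewrite ltr_norml; apply/andP; split; lra.
  have h2 : `|y - y'| < r by rewrite ltr_norml; apply/andP; split; lra.
  by rewrite mulrDr mulr1 ltrD.
apply: countable_bigcupT_measurable => [|q]; first exact: countableP.
by case: ifP => // _; apply: measurableX; exact: measurable_itv.
Qed.

End plane_measurability.

(** * Integrals over subsets of the unit disk *)

Section plane_integrals.
Variable R : realType.
Local Notation plane := (measurableTypeR R * measurableTypeR R)%type.
Local Notation toC := (@to_complex R).
Local Notation D1 := (toC @^-1` disk 1).
Implicit Types (f g : R[i] -> R[i]) (W : set R[i]).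

Lemma lebesgue_itvcc (a b : R) : a <= b -> lebesgue_measure `[a, b]%classic = (b - a)%:E.
Proof.
rewrite lebesgue_measure_itv/= lte_fin le_eqVlt => /orP[/eqP ->|->].
  by rewrite ltxx subrr.
by rewrite EFinB.
Qed.

Lemma area_disk1_le : (area R D1 <= 4%:E)%E.
Proof.
pose I : set (measurableTypeR R) := `[(-1), 1]%classic.
have mI : measurable I by exact: measurable_itv.
have sub : D1 `<=` I `*` I.
  move=> [x y]; rewrite /disk => xy1.
  have := normc_Re (x +i* y); have := normc_Im (x +i* y).
  move=> /= /le_lt_trans-/(_ _ xy1) y1 /le_lt_trans-/(_ _ xy1) x1.
  by split; rewrite /I/= in_itv/= -ler_norml ltW.
apply: (@le_trans _ _ (area R (I `*` I))).
  apply: le_measure => //; rewrite inE; first exact: measurable_disk.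
  exact: measurableX.
have -> : area R (I `*` I) = (lebesgue_measure I * lebesgue_measure I)%E.
  exact: product_measure1E.
rewrite lebesgue_itvcc; last by lra.
by rewrite -EFinM lee_fin; lra.
Qed.

Lemma area_sub_disk1_lty (D : set plane) : measurable D -> D `<=` D1 ->
  (area R D < +oo)%E.
Proof.
move=> mD sub; apply: (@le_lt_trans _ _ (area R D1)); last first.
  exact: le_lt_trans area_disk1_le (ltry _).
by apply: le_measure => //; rewrite inE//; exact: measurable_disk.
Qed.

Lemma bounded_integrable (D : set plane) (h : plane -> R) (K : R) :
  measurable D -> D `<=` D1 -> measurable_fun setT h ->
  (forall p, D p -> `|h p| <= K) -> (area R).-integrable D (EFin \o h).
Proof.
move=> mD DD1 mh hK; apply: measurable_bounded_integrable => //.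
- exact: area_sub_disk1_lty.
- exact: measurable_funTS.
- exists K; split; first exact: num_real.
  by move=> M KM p Dp /=; rewrite (le_trans (hK p Dp))// ltW.
Qed.

Lemma abs_Rintegral_le (D : set plane) (h : plane -> R) (K : R) :
  measurable D -> D `<=` D1 -> measurable_fun setT h -> 0 <= K ->
  (forall p, D p -> `|h p| <= K) -> `|\int[area R]_(p in D) h p| <= 4 * K.
Proof.
move=> mD DD1 mh K0 hK; have ih := bounded_integrable mD DD1 mh hK.
rewrite (le_trans (le_normr_Rintegral mD ih))//.
apply: (@le_trans _ _ (\int[area R]_(p in D) K)).
  apply: le_Rintegral => //.
  - exact: integrable_norm.
  - apply: (bounded_integrable (K := K)) => // p _.
    by rewrite ger0_norm.
rewrite Rintegral_cst// mulrC ler_wpM2r// -lee_fin fineK.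
  apply: le_trans area_disk1_le.
  by apply: le_measure => //; rewrite inE//; exact: measurable_disk.
by rewrite ge0_fin_numE// area_sub_disk1_lty.
Qed.

Section two_domains.
Variables W1 W2 : set R[i].
Hypotheses (mW1 : measurable (toC @^-1` W1 : set plane))
           (mW2 : measurable (toC @^-1` W2 : set plane)).
Hypotheses (sW1 : W1 `<=` disk 1) (sW2 : W2 `<=` disk 1).

Local Notation chi := (fun u => (\1_W1 u - \1_W2 u)%R : R).

Lemma preimage_indic (W : set R[i]) (p : plane) :
  (\1_W (toC p) : R) = \1_(toC @^-1` W) p.
Proof. by rewrite !indicE; congr (nat_of_bool _)%:R; apply/idP/idP; rewrite !inE. Qed.

Lemma measurable_chi : measurable_fun setT (fun p : plane => chi (toC p)).
Proof.
under eq_fun do rewrite !preimage_indic.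
by apply: measurable_funB; exact: measurable_indic.
Qed.

Lemma chi_le1 u : `|chi u| <= 1.
Proof.
by rewrite /= !indicE; case: (_ \in _); case: (_ \in _);
  rewrite /= ?subrr ?subr0 ?sub0r ?normrN ?normr1 ?normr0.
Qed.

Lemma integrable_chi :
  (area R).-integrable D1 (EFin \o (fun p => `|chi (toC p)|)).
Proof.
apply: (@bounded_integrable _ _ 1) => //; first exact: measurable_disk.
  by apply: measurableT_comp => //; exact: measurable_chi.
by move=> p _; rewrite normr_id chi_le1.
Qed.

(** The area of the symmetric difference of [W1] and [W2] inside the unit disk. *)
Definition diff_area : R := fine (norm1 (disk 1) chi).

Lemma diff_areaE : diff_area = \int[area R]_(p in D1) `|chi (toC p)|.
Proof. by []. Qed.

Lemma diff_area_ge0 : 0 <= diff_area.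
Proof. by apply: Rintegral_ge0. Qed.

Lemma Rintegral_diff_eq (h : plane -> R) (K : R) :
  measurable_fun setT h -> (forall p, D1 p -> `|h p| <= K) ->
  \int[area R]_(p in toC @^-1` W1) h p - \int[area R]_(p in toC @^-1` W2) h p =
  \int[area R]_(p in D1) (h p * chi (toC p)).
Proof.
move=> mh hK; have mD := @measurable_disk R 1.
have restr (W : set R[i]) : W `<=` disk 1 ->
    \int[area R]_(p in toC @^-1` W) h p =
    \int[area R]_(p in D1) (h p * \1_W (toC p)).
  move=> sW; rewrite -[in LHS](_ : D1 `&` toC @^-1` W = toC @^-1` W); last first.
    by apply/setIidPr => p; exact: sW.
  rewrite Rintegral_mkcondr; apply: eq_Rintegral => p _.
  rewrite preimage_indic patchE indicE; case: ifP => _; first by rewrite mulr1.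
  by rewrite mulr0.
have ih (W : set R[i]) : measurable (toC @^-1` W : set plane) ->
    (area R).-integrable D1 (EFin \o (fun p => h p * \1_W (toC p))).
  move=> mW; apply: (@bounded_integrable _ _ K) => //.
    under eq_fun do rewrite preimage_indic.
    by apply: measurable_funM => //; exact: measurable_indic.
  move=> p Dp; rewrite normrM (le_trans _ (hK p Dp))// ler_piMr//.
  by rewrite indicE; case: (_ \in _); rewrite ?normr1 ?normr0.
rewrite !restr// -RintegralB//; try exact: ih.
by apply: eq_Rintegral => p _; rewrite mulrBr.
Qed.

Lemma abs_Rintegral_diff_le (h : plane -> R) (K : R) :
  measurable_fun setT h -> (forall p, D1 p -> `|h p| <= K) ->
  `|\int[area R]_(p in toC @^-1` W1) h p -
    \int[area R]_(p in toC @^-1` W2) h p| <= K * diff_area.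
Proof.
move=> mh hK; have mD := @measurable_disk R 1.
rewrite (Rintegral_diff_eq mh hK).
have mhc : measurable_fun setT (fun p : plane => h p * chi (toC p)).
  by apply: measurable_funM => //; exact: measurable_chi.
have ih : (area R).-integrable D1 (EFin \o (fun p => h p * chi (toC p))).
  apply: (@bounded_integrable _ _ K) => // p Dp.
  by rewrite normrM (le_trans _ (hK p Dp))// ler_piMr// chi_le1.
rewrite (le_trans (le_normr_Rintegral mD ih))// diff_areaE -RintegralZl//; last first.
  exact: integrable_chi.
apply: le_Rintegral => //.
- exact: integrable_norm.
- have := integrableZl mD K integrable_chi.
  by apply: eq_integrable => // p _; rewrite /= EFinM.
- by move=> p Dp; rewrite normrM ler_wpM2r// hK.
Qed.

(** The factor 2 is the price of treating real and imaginary parts separately; it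
    only enters the universal constant. *)
Lemma normc_cintegral_diff_le f (K : R) : cmeasurable f ->
  (forall u, disk 1 u -> normc (f u) <= K) ->
  normc (cintegral W1 f - cintegral W2 f) <= 2 * K * diff_area.
Proof.
move=> [mf1 mf2] fK; rewrite (le_trans (normc_le_ReIm _))//=.
rewrite [leRHS](_ : _ = K * diff_area + K * diff_area); last by ring.
by apply: lerD; apply: abs_Rintegral_diff_le => // p Dp;
  rewrite (le_trans _ (fK _ Dp))// ?normc_Re ?normc_Im.
Qed.

End two_domains.

Section one_domain.
Variable W : set R[i].
Hypotheses (mW : measurable (toC @^-1` W : set plane)) (sW : W `<=` disk 1).

Lemma bounded_cintegrable f (K : R) : cmeasurable f ->
  (forall u, W u -> normc (f u) <= K) -> cintegrable W f.
Proof.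
by move=> [mf1 mf2] fK; split; apply: (@bounded_integrable _ _ K) => //;
  move=> p Wp; do ?[exact: sW]; rewrite (le_trans _ (fK _ Wp))// ?normc_Re ?normc_Im.
Qed.

Lemma normc_cintegral_le f (K : R) : cmeasurable f -> 0 <= K ->
  (forall u, W u -> normc (f u) <= K) -> normc (cintegral W f) <= 8 * K.
Proof.
move=> [mf1 mf2] K0 fK; rewrite (le_trans (normc_le_ReIm _))//=.
rewrite [leRHS](_ : _ = 4 * K + 4 * K); last by ring.
by apply: lerD; apply: abs_Rintegral_le => // p Wp; do ?[exact: sW];
  rewrite (le_trans _ (fK _ Wp))// ?normc_Re ?normc_Im.
Qed.

Lemma cintegralD f g : cintegrable W f -> cintegrable W g ->
  cintegral W (fun u => f u + g u) = cintegral W f + cintegral W g.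
Proof.
move=> [f1 f2] [g1 g2]; rewrite /cintegral; apply/eqP; rewrite eq_complex/=.
rewrite -!RintegralD//; apply/andP; split; apply/eqP; apply: eq_Rintegral => p _.
  by rewrite ReD.
by rewrite ImD.
Qed.

Lemma cintegrableD f g : cintegrable W f -> cintegrable W g ->
  cintegrable W (fun u => f u + g u).
Proof.
move=> [f1 f2] [g1 g2]; split.
  have := integrableD mW f1 g1; apply: eq_integrable => // p _ /=.
  by rewrite ReD.
have := integrableD mW f2 g2; apply: eq_integrable => // p _ /=.
by rewrite ImD.
Qed.

Lemma cintegralB f g : cintegrable W f -> cintegrable W g ->
  cintegral W (fun u => f u - g u) = cintegral W f - cintegral W g.
Proof.
move=> [f1 f2] [g1 g2]; rewrite /cintegral; apply/eqP; rewrite eq_complex/=.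
rewrite -!RintegralB//; apply/andP; split; apply/eqP; apply: eq_Rintegral => p _.
  by rewrite ReD ReN.
by rewrite ImD ImN.
Qed.

Lemma cintegralZ c f : cintegrable W f ->
  cintegral W (fun u => c * f u) = c * cintegral W f.
Proof.
move=> [f1 f2]; apply/eqP; rewrite eq_complex ReM ImM /=.
have i1 (r : R) : (area R).-integrable (toC @^-1` W)
    (EFin \o (fun p => r * complex.Re (f (toC p)))).
  by have := integrableZl mW r f1; apply: eq_integrable => // p _; rewrite /= EFinM.
have i2 (r : R) : (area R).-integrable (toC @^-1` W)
    (EFin \o (fun p => r * complex.Im (f (toC p)))).
  by have := integrableZl mW r f2; apply: eq_integrable => // p _; rewrite /= EFinM.
rewrite -!RintegralZl// -RintegralB// -RintegralD//.
apply/andP; split; apply/eqP; apply: eq_Rintegral => p _.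
  by rewrite ReM.
by rewrite ImM.
Qed.

Lemma cintegrable_sum n (F : nat -> R[i] -> R[i]) :
  (forall i, cintegrable W (F i)) -> cintegrable W (fun u => \sum_(i < n) F i u).
Proof.
move=> iF; elim: n => [|n IH].
  have := @bounded_cintegrable (fun=> 0) 0 (cmeasurable_cst _).
  under [X in _ -> cintegrable W X]eq_fun do rewrite big_ord0.
  by apply=> u _; rewrite normc0.
under eq_fun do rewrite big_ord_recr/=.
exact: cintegrableD.
Qed.

Lemma cintegral_sum n (F : nat -> R[i] -> R[i]) :
  (forall i, cintegrable W (F i)) ->
  cintegral W (fun u => \sum_(i < n) F i u) = \sum_(i < n) cintegral W (F i).
Proof.
move=> iF; elim: n => [|n IH].
  under eq_fun do rewrite big_ord0.
  rewrite big_ord0 /cintegral/=; under eq_Rintegral do rewrite /=.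
  by rewrite /Rintegral integral0.
under eq_fun do rewrite big_ord_recr/=.
rewrite cintegralD//; last exact: cintegrable_sum.
by rewrite IH big_ord_recr.
Qed.

End one_domain.

End plane_integrals.

(** * Moments and the kernel of the exponential transform *)

Section exponential_transform.
Variable R : realType.
Local Notation half := (2^-1 : R).

Lemma half_ge0 : 0 <= half. Proof. by rewrite invr_ge0. Qed.

(** The weights 1/2 correspond to z = 1/s and w = 1/t on the circle of radius 2,
    where the defining polynomials are to be compared. *)
Definition wiener2 (p : {poly {poly R[i]}}) : R :=
  wiener (wiener (@normc R) half) half p.

Lemma wiener1_norm : ring_norm (wiener (@normc R) half).
Proof. exact: wiener_norm (ring_norm_normc R) half_ge0. Qed.

Lemma wiener2_norm : ring_norm wiener2.
Proof. exact: wiener_norm wiener1_norm half_ge0. Qed.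

Lemma wienerX_le (A : nzRingType) (N : A -> R) (rho : R) :
  ring_norm N -> 0 <= rho -> wiener N rho 'X <= rho.
Proof.
move=> HN r0; rewrite (@wiener_wide _ _ _ _ HN 2) ?size_polyX//.
rewrite !big_ord_recl big_ord0/= !coefX/= rnorm0// mul0r add0r addr0 expr1.
by rewrite ler_piMl// rnorm1.
Qed.

Lemma wiener2_monomial (a : R[i]) k l :
  wiener2 ((a%:P * 'X^l)%:P * 'X^k) <= normc a * half ^+ l * half ^+ k.
Proof.
rewrite (le_trans (rnormM wiener2_norm _ _))//.
apply: ler_pM; try exact: rnorm_ge0 wiener2_norm _.
  rewrite /wiener2 (wienerC _ wiener1_norm).
  rewrite (le_trans (rnormM wiener1_norm _ _))//.
  apply: ler_pM; try exact: rnorm_ge0 wiener1_norm _.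
    by rewrite (wienerC _ (ring_norm_normc R)).
  exact: rnormX wiener1_norm (wienerX_le (ring_norm_normc R) half_ge0).
exact: rnormX wiener2_norm (wienerX_le wiener1_norm half_ge0).
Qed.

Lemma sum_half_le1 N : \sum_(k < N) half ^+ k.+1 <= 1.
Proof.
suff -> : \sum_(k < N) half ^+ k.+1 = 1 - half ^+ N.
  by rewrite lerBlDr lerDl exprn_ge0.
elim: N => [|N IH]; first by rewrite big_ord0 expr0 subrr.
by rewrite big_ord_recr/= IH exprS; lra.
Qed.

(** The kernel 1 / ((u - z) (conj u - conj w)) after the substitution s = 1/z,
    t = 1/(conj w) that moves infinity to the origin; see [kern_inv]. *)
Definition kern (s t u : R[i]) : R[i] := s * t / ((1 - s * u) * (1 - t * u^*%R)).

Definition ker_monomial k l (u : R[i]) : R[i] := u ^+ k * (u^*%R) ^+ l.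

Definition moment (W : set R[i]) k l : R[i] :=
  (pi^-1)%:C * cintegral W (ker_monomial k l).

(** The truncated Taylor expansion at the origin of [log_transform], with [s] as
    the outer variable and [t] as the inner one. *)
Definition moment_poly (W : set R[i]) N : {poly {poly R[i]}} :=
  \sum_(k < N) \sum_(l < N) ((moment W k l)%:P * 'X^(l.+1))%:P * 'X^(k.+1).

Lemma moment_poly_eval W N s t :
  (moment_poly W N).[s, t] =
  \sum_(k < N) \sum_(l < N) moment W k l * t ^+ l.+1 * s ^+ k.+1.
Proof.
rewrite /moment_poly horner_sum horner_sum; apply: eq_bigr => k _.
rewrite horner_sum horner_sum; apply: eq_bigr => l _.
by rewrite hornerM hornerC hornerXn hornerM -polyC_exp hornerC hornerM hornerC hornerXn.
Qed.

(** The monomials s^(k+1) t^(l+1) have total weight at most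
    (1/2 + 1/4 + ...)^2 = 1. *)
Lemma wiener2_double_sum N (a : nat -> nat -> R[i]) (K : R) : 0 <= K ->
  (forall k l, normc (a k l) <= K) ->
  wiener2 (\sum_(k < N) \sum_(l < N) ((a k l)%:P * 'X^(l.+1))%:P * 'X^(k.+1)) <= K.
Proof.
move=> K0 aK; rewrite (le_trans (rnorm_sum _ _ _ wiener2_norm))//.
apply: (@le_trans _ _ (\sum_(k < N) \sum_(l < N) K * half ^+ l.+1 * half ^+ k.+1)).
  apply: ler_sum => k _; rewrite (le_trans (rnorm_sum _ _ _ wiener2_norm))//.
  apply: ler_sum => l _; rewrite (le_trans (wiener2_monomial _ _ _))//.
  by rewrite ler_wpM2r ?exprn_ge0// ler_wpM2r ?exprn_ge0.
rewrite (eq_bigr (fun k : 'I_N => K * (\sum_(l < N) half ^+ l.+1) * half ^+ k.+1)); last first.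
  by move=> k _; rewrite mulr_sumr mulr_suml.
rewrite -mulr_sumr -mulrA ler_piMr//.
rewrite mulr_ile1 ?sum_half_le1// sumr_ge0// => k _; exact: exprn_ge0.
Qed.

Lemma normc_invpi_le z : normc ((pi^-1 : R)%:C * z) <= normc z.
Proof.
rewrite normcM normc_real ger0_norm ?invr_ge0 ?pi_ge0//.
by rewrite ler_piMl ?normc_ge0// invf_le1 ?pi_gt0// (le_trans _ (pi_ge2 R))// ler1n.
Qed.

Lemma cmeasurable_monomial k l : cmeasurable (ker_monomial k l).
Proof.
apply: cmeasurableM; apply: cmeasurableX; first exact: cmeasurable_id.
by apply: cmeasurableJ; exact: cmeasurable_id.
Qed.

Lemma normc_monomial_le1 k l u : disk 1 u -> normc (ker_monomial k l u) <= 1.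
Proof.
move=> u1; rewrite normcM !normcX normc_conj.
by rewrite mulr_ile1 ?exprn_ge0 ?normc_ge0// exprn_ile1 ?normc_ge0// ltW.
Qed.

Lemma cmeasurable_kern s t : cmeasurable (kern s t).
Proof.
apply: cmeasurableM; first exact: cmeasurable_cst.
apply: cmeasurableV; apply: cmeasurableM.
  apply: cmeasurableD; first exact: cmeasurable_cst.
  apply: cmeasurableN; apply: cmeasurableM; first exact: cmeasurable_cst.
  exact: cmeasurable_id.
apply: cmeasurableD; first exact: cmeasurable_cst.
apply: cmeasurableN; apply: cmeasurableM; first exact: cmeasurable_cst.
by apply: cmeasurableJ; exact: cmeasurable_id.
Qed.

Lemma normc_1B_ge (x : R[i]) : normc x <= half -> half <= normc (1 - x).
Proof. by move=> xh; rewrite (le_trans _ (normcB_ge _ _))// normc1; lra. Qed.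

Lemma normc_mul_disk s u : normc s <= half -> disk 1 u -> normc (s * u) <= half.
Proof.
by move=> sh u1; rewrite normcM -[leRHS]mulr1 ler_pM ?normc_ge0// ltW.
Qed.

Lemma normc_inv_pair (x y : R[i]) : normc x <= half -> normc y <= half ->
  normc ((1 - x) * (1 - y))^-1 <= 4.
Proof.
move=> xh yh; rewrite normcV normcM invf_ple ?posrE//; last first.
  by rewrite mulr_gt0// (lt_le_trans _ (normc_1B_ge _))// invr_gt0.
have -> : 4^-1 = half * half by rewrite -invfM -natrM.
by rewrite ler_pM ?half_ge0// normc_1B_ge.
Qed.

Lemma normc_st_le s t : normc s <= half -> normc t <= half -> normc (s * t) <= 4^-1.
Proof.
move=> sh th; have -> : 4^-1 = half * half by rewrite -invfM -natrM.
by rewrite normcM ler_pM ?normc_ge0.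
Qed.

Lemma normc_conj_disk (u : R[i]) : disk 1 u -> disk 1 u^*%R.
Proof. by rewrite /disk/= normc_conj. Qed.

Lemma normc_kern_le1 s t u : normc s <= half -> normc t <= half -> disk 1 u ->
  normc (kern s t u) <= 1.
Proof.
move=> sh th u1; rewrite /kern normcM.
have -> : 1 = 4^-1 * 4 :> R by rewrite mulVf.
rewrite ler_pM ?normc_ge0 ?normc_st_le// normc_inv_pair// normc_mul_disk//.
exact: normc_conj_disk.
Qed.

(** With x = s u and y = t (conj u), both of modulus at most 1/2, the remainder is
    s t / ((1 - x) (1 - y)) times x^N + y^N - x^N y^N. *)
Lemma kern_series s t u N : normc s <= half -> normc t <= half -> disk 1 u ->
  normc (kern s t u -
    \sum_(k < N) \sum_(l < N) (t ^+ l.+1 * s ^+ k.+1) * ker_monomial k l u)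
  <= 3 * half ^+ N.
Proof.
move=> sh th u1; have uc1 := normc_conj_disk u1.
have xh := normc_mul_disk sh u1; have yh := normc_mul_disk th uc1.
set x := s * u in xh; set y := t * u^*%R in yh.
have nx : 1 - x != 0.
  by apply/eqP => h; have := normc_1B_ge xh; rewrite h normc0 leNgt invr_gt0 ltr0n.
have ny : 1 - y != 0.
  by apply/eqP => h; have := normc_1B_ge yh; rewrite h normc0 leNgt invr_gt0 ltr0n.
have geo (v : R[i]) : 1 - v != 0 -> \sum_(k < N) v ^+ k = (1 - v ^+ N) / (1 - v).
  move=> v0; apply: (mulfI v0); rewrite mulrC [RHS]mulrC divfK// mulrC.
  by rewrite -opprB -[X in _ = X]opprB subrX1 mulNr.
have -> : \sum_(k < N) \sum_(l < N) (t ^+ l.+1 * s ^+ k.+1) * ker_monomial k l u =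
    s * t * ((\sum_(k < N) x ^+ k) * (\sum_(l < N) y ^+ l)).
  rewrite mulr_suml mulr_sumr; apply: eq_bigr => k _.
  rewrite !mulr_sumr; apply: eq_bigr => l _.
  by rewrite /ker_monomial /x /y !exprMn !exprS; ring.
rewrite !geo// /kern -/x -/y.
have -> : s * t / ((1 - x) * (1 - y)) -
    s * t * ((1 - x ^+ N) / (1 - x) * ((1 - y ^+ N) / (1 - y))) =
    s * t * (((1 - x) * (1 - y))^-1 * (x ^+ N + y ^+ N - x ^+ N * y ^+ N)).
  by field; rewrite nx ny.
have xN : normc (x ^+ N) <= half ^+ N by rewrite normcX lerXn2r ?nnegrE ?normc_ge0 ?half_ge0.
have yN : normc (y ^+ N) <= half ^+ N by rewrite normcX lerXn2r ?nnegrE ?normc_ge0 ?half_ge0.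
have h : normc (x ^+ N + y ^+ N - x ^+ N * y ^+ N) <= 3 * half ^+ N.
  rewrite (le_trans (normcD_le _ _))// normc_opp.
  have h1 := le_trans (normcD_le (x ^+ N) (y ^+ N)) (lerD xN yN).
  have h2 : normc (x ^+ N * y ^+ N) <= half ^+ N.
    rewrite normcM -[leRHS]mulr1 ler_pM ?normc_ge0// (le_trans yN)//.
    by rewrite exprn_ile1 ?half_ge0// invf_le1 ?ltr0n ?ler1n.
  by lra.
rewrite !normcM mulrA (le_trans _ h)// -[leRHS]mul1r ler_wpM2r ?normc_ge0//.
have -> : 1 = 4^-1 * 4 :> R by rewrite mulVf.
rewrite ler_pM ?normc_ge0 ?mulr_ge0 ?normc_ge0//; last exact: normc_inv_pair.
by rewrite -normcM normc_st_le.
Qed.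

End exponential_transform.

(** * Approximation of the exponential transform by polynomials *)

Section approximation.
Variable R : realType.
Local Notation plane := (measurableTypeR R * measurableTypeR R)%type.
Local Notation toC := (@to_complex R).
Local Notation half := (2^-1 : R).

Definition log_transform (W : set R[i]) s t : R[i] :=
  (pi^-1)%:C * cintegral W (kern s t).

Section one_domain.
Variable W : set R[i].
Hypotheses (mW : measurable (toC @^-1` W : set plane)) (sW : W `<=` disk 1).

Lemma log_transform_le s t : normc s <= half -> normc t <= half ->
  normc (log_transform W s t) <= 8.
Proof.
move=> sh th; rewrite (le_trans (normc_invpi_le _))//.
rewrite -[leRHS]mulr1 normc_cintegral_le// => [|u Wu]; first exact: cmeasurable_kern.
by apply: normc_kern_le1 => //; exact: sW.
Qed.

(** Integrate [kern_series] term by term; the integrals of the monomials are the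
    moments. *)
Lemma log_transform_approx s t N : normc s <= half -> normc t <= half ->
  normc (log_transform W s t - (moment_poly W N).[s, t]) <= 24 * half ^+ N.
Proof.
move=> sh th.
have im k l c : cintegrable W (fun u => c * ker_monomial k l u).
  apply: (@bounded_cintegrable _ _ mW sW _ (normc c)).
    by apply: cmeasurableM; [exact: cmeasurable_cst|exact: cmeasurable_monomial].
  move=> u Wu; rewrite normcM ler_piMr ?normc_ge0// normc_monomial_le1//.
  exact: sW.
have im1 k l : cintegrable W (ker_monomial k l).
  apply: (@bounded_cintegrable _ _ mW sW _ 1); first exact: cmeasurable_monomial.
  by move=> u Wu; rewrite normc_monomial_le1//; exact: sW.
pose F k u := \sum_(l < N) (t ^+ l.+1 * s ^+ k.+1) * ker_monomial k l u.
have iF k : cintegrable W (F k).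
  exact: (@cintegrable_sum _ _ mW sW N (fun l u => (t ^+ l.+1 * s ^+ k.+1) * ker_monomial k l u)).
pose S u := \sum_(k < N) F k u.
have iS : cintegrable W S by exact: cintegrable_sum.
have -> : (moment_poly W N).[s, t] = (pi^-1)%:C * cintegral W S.
  rewrite moment_poly_eval /S cintegral_sum// mulr_sumr; apply: eq_bigr => k _.
  rewrite (@cintegral_sum _ _ mW sW N (fun l u => (t ^+ l.+1 * s ^+ k.+1) * ker_monomial k l u))//.
  rewrite mulr_sumr; apply: eq_bigr => l _.
  by rewrite cintegralZ// /moment; ring.
have ik : cintegrable W (kern s t).
  apply: (@bounded_cintegrable _ _ mW sW _ 1); first exact: cmeasurable_kern.
  by move=> u Wu; rewrite normc_kern_le1//; exact: sW.
rewrite /log_transform -mulrBr (le_trans (normc_invpi_le _))//.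
rewrite -cintegralB//.
rewrite [leRHS](_ : _ = 8 * (3 * half ^+ N)); last by ring.
have K0 : 0 <= 3 * half ^+ N by rewrite mulr_ge0 ?exprn_ge0 ?half_ge0.
have mB : cmeasurable (fun u => kern s t u - S u).
  apply: cmeasurableD; first exact: cmeasurable_kern.
  apply: cmeasurableN; apply: (@cmeasurable_sum _ N F) => k.
  apply: (@cmeasurable_sum _ N (fun l u => (t ^+ l.+1 * s ^+ k.+1) * ker_monomial k l u)) => l.
  by apply: cmeasurableM; [exact: cmeasurable_cst|exact: cmeasurable_monomial].
apply: (normc_cintegral_le mW sW mB K0) => u Wu.
by apply: kern_series => //; exact: sW.
Qed.

Lemma wiener2_moment_poly N : wiener2 (moment_poly W N) <= 8.
Proof.
apply: wiener2_double_sum => // k l; rewrite (le_trans (normc_invpi_le _))//.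
rewrite -[leRHS]mulr1 normc_cintegral_le// => [|u Wu]; first exact: cmeasurable_monomial.
by apply: normc_monomial_le1; exact: sW.
Qed.

End one_domain.

(** Here [v] stands for a polynomial approximation of [z]. Both powers have a base
    of modulus at most [expR (9 / n.+1)], and the bases differ by
    O(1 / n^2) + |z - v| / n. *)
Lemma cexpN_approx (z v : R[i]) n : (16 <= n.+1)%N ->
  normc z <= 8 -> normc v <= 9 ->
  normc (cexp (- z) - (1 - (n.+1%:R^-1)%:C * v) ^+ n.+1) <=
  (640 / n.+1%:R + normc (z - v)) * expR 9.
Proof.
move=> n16 z8 v9; set r := n.+1%:R^-1 : R.
have n0 : 0 < n.+1%:R :> R by rewrite ltr0n.
have r0 : 0 < r by rewrite invr_gt0.
have rn : n.+1%:R * r = 1 by rewrite divff ?gt_eqF.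
have r16 : r <= 16^-1 by rewrite lef_pV2 ?posrE// ler_nat.
have nr (x : R[i]) : normc (r%:C * x) = r * normc x by rewrite normcM normc_real gtr0_norm.
have -> : - z = (- (r%:C * z)) *+ n.+1.
  rewrite mulNrn -mulrnAl -rmorphMn/= -mulr_natl rn.
  by rewrite (_ : 1%:C = 1 :> R[i])// mul1r.
rewrite cexpMn.
set a := cexp _; set b := 1 - _.
pose K := expR (9 * r).
have aK : normc a <= K.
  by rewrite (le_trans (normc_cexp_le _))// ler_expR normc_opp nr mulrC ler_pM2r// (le_trans z8)// ler_nat.
have bK : normc b <= K.
  rewrite (le_trans (normcD_le _ _))// normc_opp nr normc1.
  rewrite (le_trans _ (expR_ge1Dx _))// lerD2l mulrC ler_pM2r//.
have ab : normc (a - b) <= r * (640 * r + normc (z - v)).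
  have -> : a - b = (a - 1 - (- (r%:C * z))) + (- (r%:C * (z - v))) by rewrite /b; ring.
  rewrite (le_trans (normcD_le _ _))// normc_opp nr mulrDr lerD2r.
  have zr : normc (- (r%:C * z)) <= 8 * r by rewrite normc_opp nr mulrC ler_pM2r.
  rewrite (le_trans (cexp_taylor1 _))//; first by apply: (le_trans zr); lra.
  have : normc (- (r%:C * z)) ^+ 2 <= (8 * r) ^+ 2.
    by rewrite lerXn2r ?nnegrE ?normc_ge0// mulr_ge0// ltW.
  by rewrite exprMn; lra.
have := rnorm_subX n (ring_norm_normc R) aK bK.
move=> /le_trans; apply.
rewrite -mulr_natr mulrAC.
apply: ler_pM; rewrite ?mulr_ge0 ?normc_ge0 ?exprn_ge0 ?expR_ge0//.
  by rewrite -ler_pdivlMr// mulrC.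
rewrite -expRM_natl ler_expR mulrCA ler_piMr//.
by rewrite -[leRHS]rn ler_pM2r// ler_nat.
Qed.

Lemma normcB_split (a b c d : R[i]) (e : R) :
  normc (a - c) <= e / 2 -> normc (b - d) <= e / 2 ->
  normc (a - b - (c - d)) <= e.
Proof.
move=> ac bd; have -> : a - b - (c - d) = (a - c) + (- (b - d)) by ring.
by rewrite (le_trans (normcD_le _ _))// normc_opp [leRHS]splitr lerD.
Qed.

Lemma subr_1BM (A : comNzRingType) (x y z : A) :
  (1 - x * y) - (1 - x * z) = - (x * (y - z)).
Proof. by ring. Qed.

Section two_domains.
Variables W1 W2 : set R[i].
Hypotheses (mW1 : measurable (toC @^-1` W1 : set plane))
           (mW2 : measurable (toC @^-1` W2 : set plane)).
Hypotheses (sW1 : W1 `<=` disk 1) (sW2 : W2 `<=` disk 1).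

(** The moments of the two domains differ by an integral over the symmetric
    difference of a function of modulus at most 1. *)
Lemma wiener2_moment_polyB N :
  wiener2 (moment_poly W1 N - moment_poly W2 N) <= 2 * diff_area W1 W2.
Proof.
rewrite /moment_poly -sumrB.
rewrite (eq_bigr (fun k : 'I_N => \sum_(l < N)
   ((moment W1 k l - moment W2 k l)%:P * 'X^(l.+1))%:P * 'X^(k.+1))); last first.
  move=> k _; rewrite -sumrB; apply: eq_bigr => l _.
  by rewrite -mulrBl -polyCB -mulrBl -polyCB.
apply: (@wiener2_double_sum _ N (fun k l => moment W1 k l - moment W2 k l)).
  by rewrite mulr_ge0// diff_area_ge0.
move=> k l; rewrite /moment -mulrBr (le_trans (normc_invpi_le _))//.
rewrite -[2]mulr1; apply: normc_cintegral_diff_le => //.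
  exact: cmeasurable_monomial.
exact: normc_monomial_le1.
Qed.

(** The bound on the norm of the approximating polynomial does not depend on
    [eta]: this is how an estimate on the coefficients of the whole difference of
    exponentials is expressed without infinite series. The polynomial is
    (1 - p1/n)^n - (1 - p2/n)^n with [p1], [p2] truncated moment series, whose norms
    are at most 8 and whose difference has norm at most twice [diff_area]. *)
Lemma exp_transform_approx (eta : R) : 0 < eta ->
  exists p : {poly {poly R[i]}}, wiener2 p <= 2 * expR 8 * diff_area W1 W2 /\
    forall s t, normc s <= half -> normc t <= half ->
    normc (cexp (- log_transform W1 s t) - cexp (- log_transform W2 s t) - p.[s, t])
    <= eta.
Proof.
move=> eta0.
have e9 : 0 < expR 9 :> R by exact: expR_gt0.
pose eps := eta / (4 * expR 9).
have eps0 : 0 < eps by rewrite divr_gt0 ?mulr_gt0.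
have [n [n16 neps]] : exists n : nat, (16 <= n.+1)%N /\ 640 / n.+1%:R <= eps.
  have q0 : 0 <= 640 / eps by rewrite divr_ge0 ?ler0n ?(ltW eps0).
  have bq := archi_boundP q0.
  set M := Num.bound _ in bq.
  exists (maxn 16 M); split; first by rewrite ltnW// ltnS leq_maxl.
  rewrite ler_pdivrMr ?ltr0n// mulrC -ler_pdivrMr//.
  apply: (le_trans (ltW bq)); rewrite ler_nat.
  exact: leq_trans (leq_maxr _ _) (leqnSn _).
have [N Neps1 Neps] : exists2 N : nat, 24 * half ^+ N <= 1 & 24 * half ^+ N <= eps.
  have half_small (e : R) : 0 < e -> exists N, forall M, (N <= M)%N -> 24 * half ^+ M <= e.
    move=> e0; have q0 : 0 <= 24 / e by rewrite divr_ge0 ?ler0n ?(ltW e0).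
    have bq := archi_boundP q0.
    set N := Num.bound _ in bq.
    exists N => M NM.
    rewrite exprVn ler_pdivrMr ?exprn_gt0// mulrC -ler_pdivrMr//.
    apply: (le_trans (ltW bq)); rewrite -natrX ler_nat.
    exact: leq_trans NM (ltnW (ltn_expl _ _)).
  have [N1 h1] := half_small 1 ltr01; have [N2 h2] := half_small _ eps0.
  by exists (maxn N1 N2); [apply: h1|apply: h2]; rewrite ?leq_maxl ?leq_maxr.
pose r : {poly {poly R[i]}} := ((n.+1%:R^-1)%:C%:P)%:P.
pose q W := (1 - r * moment_poly W N).
exists (q W1 ^+ n.+1 - q W2 ^+ n.+1).
have n0 : 0 < n.+1%:R :> R by rewrite ltr0n.
have wr : wiener2 r = n.+1%:R^-1.
  rewrite /wiener2 (wienerC _ (wiener1_norm R)) (wienerC _ (ring_norm_normc R)).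
  by rewrite normc_real ger0_norm// invr_ge0.
split.
  pose K := expR (8 / n.+1%:R) : R.
  have qK W : measurable (toC @^-1` W : set plane) -> W `<=` disk 1 ->
      wiener2 (q W) <= K.
    move=> mW sW; rewrite (le_trans (rnormD (wiener2_norm R) _ _))//.
    rewrite (le_trans _ (expR_ge1Dx _))// lerD ?(rnorm1 (wiener2_norm R))//.
    rewrite (rnormN (wiener2_norm R)) (le_trans (rnormM (wiener2_norm R) _ _))//.
    by rewrite wr mulrC ler_pM2r ?invr_gt0// wiener2_moment_poly.
  have := rnorm_subX n (wiener2_norm R) (qK _ mW1 sW1) (qK _ mW2 sW2).
  move=> /le_trans; apply; rewrite -mulr_natr mulrAC.
  rewrite [leRHS](_ : _ = (2 * diff_area W1 W2) * expR 8); last by ring.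
  apply: ler_pM.
  - by rewrite mulr_ge0// (rnorm_ge0 (wiener2_norm R)).
  - by rewrite exprn_ge0// expR_ge0.
  - have -> : q W1 - q W2 = - (r * (moment_poly W1 N - moment_poly W2 N)).
      exact: subr_1BM.
    rewrite (rnormN (wiener2_norm R)) -ler_pdivlMr//.
    rewrite (le_trans (rnormM (wiener2_norm R) _ _))// wr mulrC.
    by rewrite ler_pM2r ?invr_gt0// wiener2_moment_polyB.
  - rewrite -expRM_natl ler_expR mulrCA ler_piMr// ler_pdivrMr// mul1r.
    by rewrite ler_nat.
move=> s t sh th.
have val W : (q W ^+ n.+1).[s, t] =
    (1 - (n.+1%:R^-1)%:C * (moment_poly W N).[s, t]) ^+ n.+1.
  by rewrite !horner_exp /q !hornerE.
have -> : (q W1 ^+ n.+1 - q W2 ^+ n.+1).[s, t] =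
    (1 - (n.+1%:R^-1)%:C * (moment_poly W1 N).[s, t]) ^+ n.+1 -
    (1 - (n.+1%:R^-1)%:C * (moment_poly W2 N).[s, t]) ^+ n.+1.
  by rewrite hornerD hornerN hornerD hornerN; congr (_ - _); exact: val.
have est W : measurable (toC @^-1` W : set plane) -> W `<=` disk 1 ->
    normc (cexp (- log_transform W s t) -
      (1 - (n.+1%:R^-1)%:C * (moment_poly W N).[s, t]) ^+ n.+1) <= eta / 2.
  move=> mW sW.
  have h1 := log_transform_le mW sW sh th.
  have h2 := log_transform_approx mW sW N sh th.
  have h3 : normc (moment_poly W N).[s, t] <= 9.
    have -> : (moment_poly W N).[s, t] = log_transform W s t +
      (- (log_transform W s t - (moment_poly W N).[s, t])) by ring.
    rewrite (le_trans (normcD_le _ _))// normc_opp.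
    by move: (lerD h1 (le_trans h2 Neps1)); lra.
  rewrite (le_trans (cexpN_approx n16 h1 h3))//.
  rewrite -ler_pdivlMr//.
  have -> : eta / 2 / expR 9 = eps + eps.
    by rewrite /eps; field; rewrite gt_eqF.
  by apply: lerD => //; exact: le_trans h2 Neps.
exact: normcB_split (est _ mW1 sW1) (est _ mW2 sW2).
Qed.

End two_domains.
End approximation.

(** * From the exponential transform to the defining polynomials *)

Section transfer.
Variable R : realType.
Local Notation half := (2^-1 : R).
Implicit Types (D : {poly {poly R[i]}}).

Lemma wiener_partial (A : nzRingType) (N : A -> R) (rho : R) m (p : {poly A}) :
  ring_norm N -> 0 <= rho -> \sum_(i < m) N p`_i * rho ^+ i <= wiener N rho p.
Proof.
move=> HN r0; rewrite (wiener_wide rho HN (leq_maxr m (size p))).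
rewrite (big_ord_widen (maxn m (size p)) (fun i => N p`_i * rho ^+ i) (leq_maxl _ _)).
rewrite big_mkcond/=; apply: ler_sum => i _; case: ifP => // _.
by rewrite mulr_ge0 ?exprn_ge0 ?rnorm_ge0.
Qed.

Lemma wiener2_partial m D :
  \sum_(i < m) \sum_(j < m) normc D`_i`_j * half ^+ j * half ^+ i <= wiener2 D.
Proof.
rewrite (le_trans _ (wiener_partial m D (wiener1_norm R) (half_ge0 R)))//.
apply: ler_sum => i _; rewrite -mulr_suml ler_wpM2r ?exprn_ge0 ?half_ge0//.
exact: wiener_partial (ring_norm_normc R) (half_ge0 R).
Qed.

Definition bidegree_lt n D := (size D <= n)%N /\ forall i, (size (D`_i)%R <= n)%N.

Lemma wiener2_wide n D : bidegree_lt n D ->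
  wiener2 D = \sum_(i < n) \sum_(j < n) normc D`_i`_j * half ^+ j * half ^+ i.
Proof.
move=> [sD sDi]; rewrite /wiener2 (wiener_wide _ (wiener1_norm R) sD).
apply: eq_bigr => i _; rewrite (wiener_wide _ (ring_norm_normc R) (sDi i)).
by rewrite mulr_suml.
Qed.

Lemma horner2_wide n D x y : bidegree_lt n D ->
  D.[x, y] = \sum_(i < n) \sum_(j < n) D`_i`_j * y ^+ j * x ^+ i.
Proof.
move=> [sD sDi]; rewrite (horner_coef_wide _ sD) horner_sum; apply: eq_bigr => i _.
rewrite hornerM -polyC_exp hornerC (horner_coef_wide _ (sDi i)).
by rewrite mulr_suml.
Qed.

(** The polynomial s^n t^n D(1/s, 1/t). *)
Definition bireverse n D : {poly {poly R[i]}} :=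
  \poly_(i < n.+1) \poly_(j < n.+1) D`_(n - i)`_(n - j).

Lemma bireverse_bidegree n D : bidegree_lt n.+1 (bireverse n D).
Proof.
split; first exact: size_poly.
move=> i; rewrite coef_poly; case: ifP => _; first exact: size_poly.
by rewrite size_poly0.
Qed.

Lemma coef_bireverse n D i j : (i < n.+1)%N -> (j < n.+1)%N ->
  (bireverse n D)`_i`_j = D`_(n - i)`_(n - j).
Proof. by move=> ni nj; rewrite coef_poly ni coef_poly nj. Qed.

Lemma bireverse_horner2 n D s t : bidegree_lt n.+1 D -> s != 0 -> t != 0 ->
  (bireverse n D).[s, t] = s ^+ n * t ^+ n * D.[s^-1, t^-1].
Proof.
move=> bD s0 t0; rewrite (horner2_wide _ _ (bireverse_bidegree n D)).
rewrite (horner2_wide _ _ bD) mulr_sumr (reindex_inj rev_ord_inj)/=.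
apply: eq_bigr => i _; rewrite mulr_sumr (reindex_inj rev_ord_inj)/=.
apply: eq_bigr => j _; rewrite !subSS coef_bireverse ?ltnS ?leq_subr//.
have iln : (i <= n)%N by rewrite -ltnS.
have jln : (j <= n)%N by rewrite -ltnS.
rewrite !subKn// !exprVn.
have -> : s ^+ (n - i) = s ^+ n / s ^+ i by rewrite expfB_cond// ?s0//= (negbTE s0).
have -> : t ^+ (n - j) = t ^+ n / t ^+ j by rewrite expfB_cond// (negbTE t0).
by ring.
Qed.

(** On |z|, |w| <= 2 the monomial z^i w^j is at most 2^i 2^j, which is 4^n times the
    weight of s^(n-i) t^(n-j) in [wiener2]. *)
Lemma normc_horner2_le n D z w : bidegree_lt n.+1 D ->
  normc z <= 2 -> normc w <= 2 ->
  normc D.[z, w] <= 2 ^+ n * 2 ^+ n * wiener2 (bireverse n D).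
Proof.
move=> bD z2 w2; rewrite (horner2_wide _ _ bD).
rewrite (wiener2_wide (bireverse_bidegree n D)).
rewrite [X in _ * X](reindex_inj rev_ord_inj)/= mulr_sumr.
rewrite (le_trans (normc_sum _ _ _))//; apply: ler_sum => i _.
rewrite [X in _ * X](reindex_inj rev_ord_inj)/= mulr_sumr.
rewrite (le_trans (normc_sum _ _ _))//; apply: ler_sum => j _.
rewrite !subSS coef_bireverse ?ltnS ?leq_subr//.
have iln : (i <= n)%N by rewrite -ltnS.
have jln : (j <= n)%N by rewrite -ltnS.
rewrite !subKn//.
have pow2 k : (k <= n)%N -> 2 ^+ n * half ^+ (n - k) = 2 ^+ k.
  move=> kn; rewrite -{1}(subnKC kn) exprD -mulrA -exprMn divff// expr1n mulr1 //.
rewrite [leRHS](_ : _ = normc D`_i`_j * (2 ^+ n * half ^+ (n - j)) *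
  (2 ^+ n * half ^+ (n - i))); last by ring.
rewrite !pow2// !normcM !normcX.
by rewrite !ler_pM ?mulr_ge0 ?exprn_ge0 ?normc_ge0// lerXn2r ?nnegrE ?normc_ge0.
Qed.

Section nodes.
Variable a : seq R[i].
Hypothesis a1 : {in a, forall x, normc x <= 1}.

(** [bireverse] of P(z) times the conjugate of P(w), for P monic with zeros [a];
    see [node_poly2_reverse]. *)
Definition node_poly2 : {poly {poly R[i]}} :=
  (\prod_(x <- a) (1 - x%:P%:P * 'X)) * (\prod_(x <- a) (1 - (x^*%R%:P * 'X)%:P)).

Lemma wiener2_node_poly2 :
  wiener2 node_poly2 <= (3 / 2) ^+ size a * (3 / 2) ^+ size a.
Proof.
have W := wiener2_norm R; have W1 := wiener1_norm R; have W0 := ring_norm_normc R.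
rewrite (le_trans (rnormM W _ _))//; apply: ler_pM; try exact: rnorm_ge0 W _.
  apply: (rnorm_prod W) => x xa; rewrite (le_trans (rnormD W _ _))// (rnormN W).
  rewrite (le_trans (lerD (rnorm1 W) (rnormM W _ _)))//.
  have h1 : wiener2 x%:P%:P <= 1 by rewrite /wiener2 (wienerC _ W1) (wienerC _ W0) a1.
  have h2 := wienerX_le W1 (half_ge0 R).
  have := ler_pM (rnorm_ge0 W _) (rnorm_ge0 W _) h1 h2.
  by rewrite /wiener2; lra.
apply: (rnorm_prod W) => x xa; rewrite (le_trans (rnormD W _ _))// (rnormN W).
have h0 : wiener2 (x^*%R%:P * 'X)%:P <= 1 * half.
  rewrite /wiener2 (wienerC _ W1) (le_trans (rnormM W1 _ _))//.
  apply: ler_pM; try exact: rnorm_ge0 W1 _.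
    by rewrite (wienerC _ W0) normc_conj a1.
  exact: wienerX_le W0 (half_ge0 R).
by apply: (le_trans (lerD (rnorm1 W) h0)); lra.
Qed.

Lemma node_poly2_eval s t : node_poly2.[s, t] =
  (\prod_(x <- a) (1 - x * s)) * (\prod_(x <- a) (1 - x^*%R * t)).
Proof.
rewrite /node_poly2 hornerM !horner_prod hornerM !horner_prod; congr (_ * _).
  by apply: eq_bigr => x _; rewrite !hornerE.
by apply: eq_bigr => x _; rewrite !hornerE.
Qed.

Lemma normc_node_poly2 s t : normc s <= half -> normc t <= half ->
  normc node_poly2.[s, t] <= (3 / 2) ^+ size a * (3 / 2) ^+ size a.
Proof.
move=> sh th; rewrite node_poly2_eval normcM.
have H v (b : seq R[i]) : normc v <= half -> {in b, forall x, normc x <= 1} ->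
    normc (\prod_(x <- b) (1 - x * v)) <= (3 / 2) ^+ size b.
  move=> vh b1; apply: (rnorm_prod (ring_norm_normc R)) => x xb.
  rewrite (le_trans (normcD_le _ _))// normc_opp normc1 normcM.
  by have := ler_pM (normc_ge0 _) (normc_ge0 _) (b1 _ xb) vh; lra.
apply: ler_pM; rewrite ?normc_ge0 ?H//.
rewrite -(big_map (fun x : R[i] => x^*%R) xpredT (fun x => 1 - x * t)).
rewrite -[X in _ ^+ X](size_map (fun x : R[i] => x^*%R)); apply: H => // x.
by case/mapP => y ya ->; rewrite normc_conj a1.
Qed.

Lemma node_poly2_reverse (P := \prod_(x <- a) ('X - x%:P)) s t :
  s != 0 -> t != 0 ->
  s ^+ size a * t ^+ size a * (P.[s^-1] * (P.[(t^-1)^*%R])^*%R) = node_poly2.[s, t].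
Proof.
have scale v (F : R[i] -> R[i]) (b : seq R[i]) :
    v ^+ size b * \prod_(x <- b) F x = \prod_(x <- b) (v * F x).
  elim: b => [|x b IH]; first by rewrite !big_nil mulr1.
  by rewrite !big_cons exprS -IH; ring.
move=> s0 t0; rewrite node_poly2_eval /P mulrACA; congr (_ * _).
  rewrite horner_prod scale; apply: eq_bigr => x _.
  by rewrite hornerXsubC mulrBr divff// mulrC.
rewrite horner_prod rmorph_prod scale; apply: eq_bigr => x _.
by rewrite hornerXsubC rmorphB/= conjCK mulrBr divff// mulrC.
Qed.

(** After inversion, the hypothesis says that [bireverse d D] is [node_poly2] times
    [E] near the origin. Let [p] be an approximation of [E]: on a small torus
    [bireverse d D] and [node_poly2 * p] are uniformly close, hence, by Cauchy's
    estimate on that fixed torus, their coefficients are close, and only finitely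
    many of them matter. Thus [wiener2] of [bireverse d D] is at most that of
    [node_poly2 * p] up to an arbitrarily small error. Arguing on coefficients
    carries the information from large |z|, |w| to |z|, |w| <= 2 without analytic
    continuation, and the factor (3/2)^(2d) 4^d = 3^(2d) is not degraded. *)
Lemma transfer_estimate D (E : R[i] -> R[i] -> R[i]) (B M : R)
    (P := \prod_(x <- a) ('X - x%:P)) (d := size a) :
  bidegree_lt d.+1 D ->
  (forall eta : R, 0 < eta -> exists p : {poly {poly R[i]}}, wiener2 p <= B /\
    forall s t, normc s <= half -> normc t <= half -> normc (E s t - p.[s, t]) <= eta) ->
  (forall z w, M < normc z -> M < normc w ->
    D.[z, w^*%R] = P.[z] * (P.[w])^*%R * E z^-1 (w^*%R)^-1) ->
  forall z w, normc z <= 2 -> normc w <= 2 -> normc D.[z, w] <= 3 ^+ (2 * d) * B.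
Proof.
move=> bD Eapprox DE z w z2 w2.
apply: (le_trans (normc_horner2_le bD z2 w2)).
suff H : wiener2 (bireverse d D) <= (3 / 2) ^+ d * (3 / 2) ^+ d * B.
  have -> : 3 ^+ (2 * d) * B = 2 ^+ d * 2 ^+ d * ((3 / 2) ^+ d * (3 / 2) ^+ d * B) :> R.
    have e9 : 3 ^+ 2 = 2 * 2 * (3 / 2 * (3 / 2)) :> R by rewrite expr2; field.
    by rewrite exprM e9 !exprMn; ring.
  by rewrite ler_wpM2l// mulr_ge0 ?exprn_ge0.
set K := (3 / 2) ^+ d * (3 / 2) ^+ d.
have K0 : 0 <= K by rewrite mulr_ge0 ?exprn_ge0 ?divr_ge0.
(* [1 / r] exceeds [M], so the identity [DE] holds on the torus of radius [r],
   and [r <= 1/2], so the approximations [p] are valid there. *)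
pose r := (Num.max M 2 + 1)^-1.
have m2 : 2 <= Num.max M 2 by rewrite le_max lexx orbT.
have mM : M <= Num.max M 2 by rewrite le_max lexx.
have r0 : 0 < r by rewrite invr_gt0; lra.
have rh : r <= half by rewrite lef_pV2 ?posrE; lra.
pose G := K / r ^+ (d + d).
have G0 : 0 <= G by rewrite divr_ge0// exprn_ge0// ltW.
have key eta : 0 < eta -> wiener2 (bireverse d D) <= K * B + (d.+1%:R * d.+1%:R) * G * eta.
  move=> eta0; have [p [pB pE]] := Eapprox _ eta0.
  have coefle i j : (i < d.+1)%N -> (j < d.+1)%N ->
      normc (bireverse d D)`_i`_j <= normc (node_poly2 * p)`_i`_j + G * eta.
    move=> id jd.
    have : normc (bireverse d D - node_poly2 * p)`_i`_j * r ^+ (i + j) <= K * eta.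
      apply: cauchy_estimate2 => // s t sr tr.
      have nz v : normc v = r -> v != 0.
        by move=> vr; apply/eqP => v0; move: vr r0; rewrite v0 normc0 => <-; rewrite ltxx.
      have big v : normc v = r -> M < normc v^-1.
        by move=> vr; rewrite normcV vr invrK; lra.
      have -> : (bireverse d D - node_poly2 * p).[s, t] =
          node_poly2.[s, t] * (E s t - p.[s, t]).
        rewrite hornerD hornerN hornerM hornerD hornerN hornerM mulrBr; congr (_ - _).
        rewrite (bireverse_horner2 bD) ?nz//.
        have := DE s^-1 (t^-1)^*%R; rewrite normc_conj conjCK !invrK => -> //; try exact: big.
        by rewrite mulrA -/d node_poly2_reverse ?nz.
      by rewrite normcM ler_pM ?normc_ge0 ?normc_node_poly2 ?pE ?sr ?tr.
    rewrite -ler_pdivlMr ?exprn_gt0// => h.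
    have h2 : K * eta / r ^+ (i + j) <= G * eta.
      rewrite /G mulrAC ler_wpM2r ?(ltW eta0)// ler_wpM2l//.
      rewrite lef_pV2 ?posrE ?exprn_gt0//.
      rewrite ler_wiXn2l ?(ltW r0) ?leq_add//; lra.
    rewrite -lerBlDl (le_trans _ (le_trans h h2))//.
    by rewrite !coefB normcB_ge.
  rewrite (wiener2_wide (bireverse_bidegree d D)).
  apply: (@le_trans _ _ (\sum_(i < d.+1) \sum_(j < d.+1)
     (normc (node_poly2 * p)`_i`_j * half ^+ j * half ^+ i + G * eta))).
    apply: ler_sum => i _; apply: ler_sum => j _.
    have h := coefle i j (ltn_ord i) (ltn_ord j).
    have p1 k : half ^+ k <= 1 by rewrite exprn_ile1 ?half_ge0// invf_le1 ?ler1n.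
    have p0 k : 0 <= half ^+ k by rewrite exprn_ge0 ?half_ge0.
    apply: (@le_trans _ _ ((normc (node_poly2 * p)`_i`_j + G * eta) * half ^+ j * half ^+ i)).
      by rewrite !ler_wpM2r.
    have Ge0 : 0 <= G * eta by rewrite mulr_ge0// ltW.
    rewrite mulrDl mulrDl lerD2l -(mulrA (G * eta)); apply: ler_piMr => //.
    by apply: mulr_ile1.
  under eq_bigr do rewrite big_split/= sumr_const card_ord.
  rewrite big_split/= sumr_const card_ord; apply: lerD.
    rewrite (le_trans (wiener2_partial _ _))// (le_trans (rnormM (wiener2_norm R) _ _))//.
    apply: ler_pM; rewrite ?(rnorm_ge0 (wiener2_norm R))//.
    exact: wiener2_node_poly2.
  rewrite -mulrnA -(mulr_natl (G * eta)) natrM.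
  by rewrite -(mulrA _ G eta).
apply/ler_addgt0Pr => e e0.
pose H := d.+1%:R * d.+1%:R * G + 1.
have H0 : 0 < H by rewrite ltr_wpDl ?ltr01// mulr_ge0// mulr_ge0.
have := key (e / H) (divr_gt0 e0 H0).
move=> /le_trans; apply; rewrite lerD2l mulrA ler_pdivrMr// mulrC ler_pM2l//.
by rewrite /H lerDl.
Qed.

End nodes.
End transfer.

(** * Stability of the defining polynomial in terms of area *)

Section defining_polynomials.
Variable R : realType.
Local Notation half := (2^-1 : R).
Implicit Types (p P : {poly R[i]}) (Q : {poly {poly R[i]}}) (W : set R[i]).
Implicit Types (z w u : R[i]).

Definition conj_poly p : {poly R[i]} := map_poly (fun c : R[i] => c^*%R) p.

Lemma coef_conj_poly p i : (conj_poly p)`_i = (p`_i)^*%R.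
Proof. by rewrite coef_map_id0// rmorph0. Qed.

Lemma conj_poly_horner p z : (conj_poly p).[z^*%R] = (p.[z])^*%R.
Proof. by rewrite -horner_map. Qed.

Lemma size_conj_poly p : size (conj_poly p) = size p.
Proof. by rewrite size_map_inj_poly ?rmorph0//; exact: (can_inj (@conjCK _)). Qed.

Lemma poly_sqr_norm_horner2 p x y :
  (poly_sqr_norm p).[x, y] = p.[x] * (conj_poly p).[y].
Proof.
by rewrite /poly_sqr_norm hornerM hornerC hornerM horner_map/= hornerC.
Qed.

Lemma poly_sqr_norm_bidegree p n : (size p <= n)%N -> bidegree_lt n (poly_sqr_norm p).
Proof.
move=> pn; have coefE i : (poly_sqr_norm p)`_i = p`_i *: conj_poly p.
  by rewrite /poly_sqr_norm coefMC coef_map/= mul_polyC.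
split=> [|i]; last by rewrite coefE (leq_trans (size_scale_leq _ _))// size_conj_poly.
apply/leq_sizeP => j nj; rewrite coefE nth_default ?scale0r//.
exact: leq_trans nj.
Qed.

Lemma bidegreeB n Q1 Q2 : bidegree_lt n Q1 -> bidegree_lt n Q2 ->
  bidegree_lt n (Q1 - Q2).
Proof.
move=> [s1 c1] [s2 c2]; split=> [|i].
  by rewrite (leq_trans (size_polyD _ _))// size_polyN geq_max s1.
by rewrite coefB (leq_trans (size_polyD _ _))// size_polyN geq_max c1 c2.
Qed.

Lemma bidegree_sum n m (F : nat -> {poly {poly R[i]}}) :
  (forall i, (i < m)%N -> bidegree_lt n (F i)) ->
  bidegree_lt n (\sum_(i < m) F i).
Proof.
move=> bF; split=> [|i].
  by rewrite (leq_trans (size_sum _ _ _))//; apply/bigmax_leqP => i _; have [] := bF i (ltn_ord i).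
rewrite coef_sum (leq_trans (size_sum _ _ _))//; apply/bigmax_leqP => j _.
by have [] := bF j (ltn_ord j).
Qed.

Lemma defining_polynomial_bidegree d (a : d.-tuple R[i]) W Q :
  defining_polynomial (\prod_(x <- a) ('X - x%:P)) W Q -> bidegree_lt d.+1 Q.
Proof.
rewrite /defining_polynomial size_prod_XsubC size_tuple/=.
move=> [_ [p [sp _ ->]] _ _]; apply: bidegreeB.
  by apply: poly_sqr_norm_bidegree; rewrite sp.
apply: (@bidegree_sum _ d (fun j => poly_sqr_norm (p j))) => j jd.
by apply: poly_sqr_norm_bidegree; rewrite sp ?ltnS ltnW.
Qed.

Lemma kern_inv z w u : z != 0 -> w != 0 ->
  kern z^-1 (w^*%R)^-1 u = ((u - z) * (u^*%R - w^*%R))^-1.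
Proof.
move=> z0 w0; have w0' : w^*%R != 0 by rewrite conjC_eq0.
have -> : (u - z) * (u^*%R - w^*%R) =
    (z * w^*%R) * ((1 - z^-1 * u) * (1 - (w^*%R)^-1 * u^*%R)).
  by field; rewrite z0 w0'.
by rewrite /kern (invfM (z * _)) (invfM z).
Qed.

(** The nodes lie in the closed unit disk, so P does not vanish beyond radius 1 and
    the quotient in the exponential identity can be cleared. *)
Lemma exponential_transformE (a : seq R[i]) W Q : {in a, forall x, normc x <= 1} ->
  defining_polynomial (\prod_(x <- a) ('X - x%:P)) W Q ->
  exists M : R, forall z w, M < normc z -> M < normc w ->
    polarized Q z w = (\prod_(x <- a) ('X - x%:P)).[z] *
      ((\prod_(x <- a) ('X - x%:P)).[w])^*%R *
      cexp (- log_transform W z^-1 (w^*%R)^-1).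
Proof.
move=> a1 [_ _ _ [M HM]]; exists (Num.max M 1) => z w; rewrite !gt_max.
move=> /andP[Mz z1] /andP[Mw w1].
have nz (v : R[i]) : 1 < normc v -> v != 0.
  by move=> v1; apply/eqP => v0; move: v1; rewrite v0 normc0 ltr10.
have Pnz v : 1 < normc v -> (\prod_(x <- a) ('X - x%:P)).[v] != 0.
  move=> v1; rewrite horner_prod prodf_seq_neq0; apply/allP => x xa /=.
  rewrite hornerXsubC subr_eq0; apply/eqP => vx; move: (a1 _ xa).
  by rewrite -vx leNgt v1.
have := HM z w Mz Mw; set P := \prod_(x <- a) _ => HE.
have PP : P.[z] * (P.[w])^*%R != 0 by rewrite mulf_neq0 ?conjC_eq0 ?Pnz.
rewrite -[LHS](divfK PP) -HE mulrC; congr (_ * cexp _).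
rewrite mulNr; congr (- (_ * _)); congr cintegral.
by apply/funext => u; rewrite kern_inv ?nz.
Qed.

Lemma defining_polynomial_stable d (a : d.-tuple R[i]) W1 W2
    (P := \prod_(x <- a) ('X - x%:P)) Q1 Q2 z :
  quadrature_domain a W1 -> W1 `<=` disk 1 ->
  quadrature_domain a W2 -> W2 `<=` disk 1 ->
  defining_polynomial P W1 Q1 -> defining_polynomial P W2 Q2 ->
  normc z <= 2 ->
  normc (polarized Q1 z z - polarized Q2 z z) <=
  3 ^+ (2 * d) * (2 * expR 8 * diff_area W1 W2).
Proof.
move=> [_ o1 _ aW1 _] s1 [_ o2 _ _ _] s2 d1 d2 z2.
have m1 := measurable_open_preimage o1; have m2 := measurable_open_preimage o2.
have a1 : {in a, forall x, normc x <= 1}.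
  by move=> x /aW1 /s1; rewrite /disk/= => /ltW.
have [M1 H1] := exponential_transformE a1 d1.
have [M2 H2] := exponential_transformE a1 d2.
have bD : bidegree_lt (size a).+1 (Q1 - Q2).
  rewrite size_tuple; apply: bidegreeB; exact: defining_polynomial_bidegree d1 || exact: defining_polynomial_bidegree d2.
have DE z' w' : Num.max M1 M2 < normc z' -> Num.max M1 M2 < normc w' ->
    (Q1 - Q2).[z', w'^*%R] = P.[z'] * (P.[w'])^*%R *
      (cexp (- log_transform W1 z'^-1 (w'^*%R)^-1) -
       cexp (- log_transform W2 z'^-1 (w'^*%R)^-1)).
  rewrite !gt_max => /andP[z1 z2'] /andP[w1 w2'].
  have := H1 z' w' z1 w1; have := H2 z' w' z2' w2'; rewrite /polarized -/P => e2 e1.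
  by rewrite mulrBr -e1 -e2 hornerD hornerN hornerD hornerN.
have approx (eta : R) : 0 < eta -> exists p : {poly {poly R[i]}},
    wiener2 p <= 2 * expR 8 * diff_area W1 W2 /\
    forall s t, normc s <= half -> normc t <= half ->
    normc (cexp (- log_transform W1 s t) - cexp (- log_transform W2 s t) - p.[s, t])
    <= eta.
  by move=> eta0; exact: exp_transform_approx.
have zc : normc z^*%R <= 2 by rewrite normc_conj.
have := transfer_estimate a1 bD approx DE z2 zc.
by rewrite size_tuple /polarized hornerD hornerN hornerD hornerN.
Qed.

End defining_polynomials.

(** * Lagrange interpolation at separated points *)

Section lagrange.

(** Compare the coefficients of degree [n] in the interpolation formula. *)
Lemma lagrange_lead_coef (K : fieldType) n (x : nat -> K) (f : {poly K}) :
  injective x -> (size f <= n.+1)%N ->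
  f`_n = \sum_(i < n.+1) f.[x i] / \prod_(j < n.+1 | j != i) (x i - x j).
Proof.
move=> xinj sf.
rewrite [in LHS](@lagrange_gen _ _ x (ltn0Sn n) xinj f sf) coef_sum.
apply: eq_bigr => i _; rewrite coefCM (lagrangeE (ltn0Sn n) xinj)/= coefCM; congr (_ * _).
set p := \prod_(_ < _ | _) _.
have -> : p.[x i] = \prod_(j < n.+1 | j != i) (x i - x j).
  by rewrite /p horner_prod; apply: eq_bigr => j _; rewrite hornerXsubC.
suff -> : p`_n = 1 by rewrite mulr1.
have sp : size p = n.+1.
  rewrite /p -big_filter size_prod_XsubC; congr _.+1.
  by rewrite -sum1_size big_filter (sum1_card (predC1 i)) cardC1 card_ord.
have mp : p \is monic by apply: monic_prod => j _; rewrite monicXsubC.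
by move/monicP: mp; rewrite /lead_coef sp.
Qed.

Variable R : realType.

(** The points on the left of [x i] are at distance at least h, 2h, ..., ih, those
    on its right at distance at least h, 2h, ..., (n-i)h. *)
Lemma prod_dist_ge (x : nat -> R) (h : R) n (i : 'I_n.+1) : 0 <= h ->
  (forall k, x k + h <= x k.+1) ->
  h ^+ n * (i`! * (n - i)`!)%:R <= \prod_(j < n.+1 | j != i) `|x i - x j|.
Proof.
move=> h0 xh.
have gap k m : x k + h * m%:R <= x (k + m)%N.
  elim: m => [|m IH]; first by rewrite mulr0 addr0 addn0.
  rewrite addnS (le_trans _ (xh _))// -natr1 mulrDr mulr1 addrA.
  by rewrite lerD2r.
have split_prod : \prod_(j < n.+1 | j != i) `|x i - x j| =
    (\prod_(0 <= j < i) `|x i - x j|) * \prod_(i.+1 <= j < n.+1) `|x i - x j|.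
  rewrite -(big_mkord (fun j => j != i :> nat) (fun j => `|x i - x j|)).
  rewrite (@big_cat_nat _ _ _ i) ?(ltnW (ltn_ord i))//=; congr (_ * _).
    rewrite [LHS]big_nat_cond [RHS]big_nat_cond; apply: eq_bigl => j.
    by rewrite /= andbT; case: (ltngtP j i) => //; rewrite ?andbF ?andbT.
  rewrite (@big_cat_nat _ _ _ i.+1) ?ltn_ord//=.
  rewrite big_ltn_cond// eqxx/= big_geq// mul1r.
  rewrite [LHS]big_nat_cond [RHS]big_nat_cond; apply: eq_bigl => j.
  by rewrite /= andbT; case: (ltngtP j i) => //; rewrite ?andbF ?andbT.
have -> : h ^+ n * (i`! * (n - i)`!)%:R =
    (h ^+ i * (i`!)%:R) * (h ^+ (n - i) * ((n - i)`!)%:R).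
  have ilen : (i <= n)%N by rewrite -ltnS.
  by rewrite mulrACA -exprD (subnKC ilen) natrM.
rewrite split_prod; apply: ler_pM.
- by rewrite mulr_ge0 ?exprn_ge0.
- by rewrite mulr_ge0 ?exprn_ge0.
- rewrite big_mkord -ffactnn ffact_prod natr_prod -[X in h ^+ X]card_ord.
  rewrite -prodr_const -big_split/=; apply: ler_prod => j _.
  rewrite mulr_ge0//= (le_trans _ (ler_norm _))// lerBrDl.
  by rewrite (le_trans (gap _ _))// subnKC// ltnW.
- have -> : \prod_(i.+1 <= j < n.+1) `|x i - x j| =
      \prod_(0 <= j < n - i) `|x i - x (j + i.+1)%N|.
    by rewrite -{1}[i.+1]add0n big_addn subSS.
  rewrite fact_prod natr_prod big_add1/= -[X in h ^+ X]subn0 -prodr_const_nat.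
  rewrite -big_split/= !big_mkord.
  apply: ler_prod => j _; rewrite mulr_ge0//= distrC (le_trans _ (ler_norm _))//.
  have -> : (j + i.+1 = i + j.+1)%N by rewrite addnS addnC addnS.
  by rewrite lerBrDl gap.
Qed.

End lagrange.

(** * Polya's bound for the sublevel sets of monic polynomials *)

Section polya.
Variable R : realType.
Local Notation mu := (@lebesgue_measure R).

(** Greedy choice: take a point of [E] close to its infimum and remove from [E]
    everything within [h] on its right, which costs little more than [h] in measure.
    The sequence is infinite only to make [x] total and injective; beyond index [k]
    its points need not lie in [E]. *)
Lemma separated_points (h : R) k (E : set R) (a b : R) : 0 < h ->
  measurable E -> E `<=` `[a, b]%classic -> ((k%:R * h)%:E < mu E)%E ->
  exists x : nat -> R, (forall i, x i + h <= x i.+1) /\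
    (forall i, (i <= k)%N -> E (x i)).
Proof.
move=> h0; elim: k E => [|k IH] E mE Eab muE.
  have [x0 Ex0] : E !=set0.
    by apply/set0P/eqP => E0; move: muE; rewrite E0 measure0 mul0r ltxx.
  exists (fun i => x0 + i%:R * h); split=> i.
    by rewrite -natr1 mulrDl mul1r addrA.
  by rewrite leqn0 => /eqP ->; rewrite mul0r addr0.
have [x1 Ex1] : E !=set0.
  apply/set0P/eqP => E0; move: muE; rewrite E0 measure0 lte_fin.
  by rewrite ltNge mulr_ge0// ltW.
have ab : a <= b.
  by have := Eab _ Ex1; rewrite /= in_itv/= => /andP[]; exact: le_trans.
have fE : mu E \is a fin_num.
  rewrite ge0_fin_numE// (@le_lt_trans _ _ (mu `[a, b]%classic))//.
    by apply: le_measure => //; rewrite ?inE.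
  by rewrite lebesgue_itvcc// ltry.
have hE : has_inf E.
  split; first by exists x1.
  by exists a => y /Eab; rewrite /= in_itv/= => /andP[].
pose d := (fine (mu E) - k.+1%:R * h) / 2.
have d0 : 0 < d.
  by rewrite divr_gt0// subr_gt0; move: muE; rewrite -{1}(fineK fE) lte_fin.
have [x0 Ex0 x0lt] := inf_adherent d0 hE.
pose E' := E `&` `[x0 + h, +oo[%classic.
have mE' : measurable E' by apply: measurableI.
have muE' : ((k%:R * h)%:E < mu E')%E.
  have sub : E `<=` E' `|` `[inf E, inf E + d + h]%classic.
    move=> y Ey; have [yl|yl] := leP (x0 + h) y; [left|right].
      by split=> //=; rewrite in_itv/= yl.
    rewrite /= in_itv/= ge_inf//; last by case: hE.
    by rewrite ltW// (lt_le_trans yl)// lerD2r ltW.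
  have fE' : mu E' \is a fin_num.
    rewrite ge0_fin_numE// (@le_lt_trans _ _ (mu E))//.
      by apply: le_measure; rewrite ?inE//; exact: subIsetl.
    by rewrite -ge0_fin_numE.
  have : (mu E <= mu E' + (d + h)%:E)%E.
    apply: (@le_trans _ _ (mu (E' `|` `[inf E, inf E + d + h]%classic))).
      by apply: le_measure; rewrite ?inE//; apply: measurableU.
    have <- : mu `[inf E, inf E + d + h]%classic = (d + h)%:E.
      rewrite lebesgue_itvcc; last by rewrite -addrA lerDl addr_ge0 ?ltW.
      by congr EFin; ring.
    exact: measureU2.
  rewrite -(fineK fE) -(fineK fE') -EFinD lee_fin lte_fin.
  by move: d0; rewrite /d -natr1; lra.
have [|x [xh xE]] := IH E' mE' _ muE'.
  by move=> y [/Eab].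
exists (fun i => if i is j.+1 then x j else x0); split=> [[|i]|[|i] ik]//.
  by have [_] := xE 0%N (leq0n _); rewrite /= in_itv/= andbT.
by have [] := xE i ik.
Qed.

(** n^n <= (2n)(2n-1)...(n+1) = 'C(2n, n) n!, and 'C(2n, n) < 2^(2n). *)
Lemma expnn_lt_fact n : (0 < n)%N -> (n ^ n < 4 ^ n * n`!)%N.
Proof.
move=> n0; have h1 : (n ^ n <= (n + n) ^_ n)%N.
  rewrite ffact_prod -[X in (n ^ X <= _)%N]card_ord -prod_nat_const.
  by apply: leq_prod => i _; have := ltn_ord i; lia.
rewrite (leq_ltn_trans h1)// -bin_ffact ltn_pmul2r ?fact_gt0//.
have -> : (4 ^ n = 2 ^ (n + n))%N by rewrite expnD -expnMn.
have := Pascal 1 1 (n + n); rewrite addn1 => ->.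
rewrite (bigD1 ord0)//= (bigD1 (inord n))/=; last first.
  by rewrite -val_eqE/= inordK ?ltnS ?leq_addr// -lt0n.
by rewrite inordK ?ltnS ?leq_addr// !exp1n !muln1 bin0 addnA add1n leq_addr.
Qed.

(** If [E] had measure greater than 8 delta, it would contain n+1 points at
    successive distances at least h = 8 delta / n, and Lagrange interpolation would
    bound the leading coefficient 1 by
    delta^n 2^n / (h^n n!) = (n/4)^n / n! < 1. The constant 8 does not depend on the
    degree; summing over the roots of [f] instead would cost a factor n. *)
Lemma polya_sublevel (f : {poly R[i]}) n (delta a b : R) (E : set R) :
  (0 < n)%N -> f \is monic -> size f = n.+1 -> 0 < delta ->
  measurable E -> E `<=` `[a, b]%classic ->
  (forall y, E y -> normc f.[y%:C] <= delta ^+ n) ->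
  (mu E <= (8 * delta)%:E)%E.
Proof.
move=> n0 fm sf d0 mE Eab fE; rewrite leNgt; apply/negP => muE.
pose h := 8 * delta / n%:R.
have nR : 0 < n%:R :> R by rewrite ltr0n.
have h0 : 0 < h by rewrite divr_gt0 ?mulr_gt0.
have [|x [xh xE]] := @separated_points h n E a b h0 mE Eab.
  by rewrite /h mulrC divfK ?gt_eqF.
have xlt i j : (i < j)%N -> x i < x j.
  elim: j => // j IH; rewrite ltnS leq_eqVlt => /orP[/eqP ->|/IH ij].
    by rewrite (lt_le_trans _ (xh _))// ltrDl.
  by rewrite (lt_trans ij)// (lt_le_trans _ (xh _))// ltrDl.
have xinj : injective (fun i => (x i)%:C).
  move=> i j /complexI ij; case: (ltngtP i j) => // /xlt; rewrite ij ltxx//.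
have := lagrange_lead_coef xinj (eq_leq sf).
have -> : f`_n = 1 by move/monicP: fm; rewrite /lead_coef sf.
move=> /(congr1 (@normc R)); rewrite normc1 => /eqP; apply/negP.
rewrite gt_eqF//.
apply: (@le_lt_trans _ _ (\sum_(i < n.+1) delta ^+ n / (h ^+ n * (i`! * (n - i)`!)%:R))).
  rewrite (le_trans (normc_sum _ _ _))//; apply: ler_sum => i _.
  have p0 : 0 < h ^+ n * (i`! * (n - i)`!)%:R.
    by rewrite mulr_gt0 ?exprn_gt0// ltr0n muln_gt0 !fact_gt0.
  rewrite normcM normcV normc_prod.
  rewrite (eq_bigr (fun j : 'I_n.+1 => `|x i - x j|)); last first.
    by move=> j _; rewrite -rmorphB normc_real.
  apply: ler_pM; rewrite ?normc_ge0//.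
  - by rewrite invr_ge0 prodr_ge0.
  - by apply: fE; apply: xE; rewrite -ltnS.
  - rewrite lef_pV2 ?posrE//; first exact: prod_dist_ge (ltW h0) xh.
    exact: lt_le_trans p0 (prod_dist_ge i (ltW h0) xh).
have nf : 0 < (n`!)%:R :> R by rewrite ltr0n fact_gt0.
have -> : \sum_(i < n.+1) delta ^+ n / (h ^+ n * (i`! * (n - i)`!)%:R) =
    (delta / h) ^+ n / (n`!)%:R * (2 ^ n)%:R.
  have := Pascal 1 1 n; rewrite addn1 => ->; rewrite natr_sum mulr_sumr.
  apply: eq_bigr => i _; rewrite !exp1n !muln1 (expr_div_n delta).
  have i0 : (i <= n)%N by rewrite -ltnS.
  have e : (n`!)%:R = ('C(n, i))%:R * (i`! * (n - i)`!)%:R :> R.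
    by rewrite -natrM bin_fact.
  have c0 : ('C(n, i))%:R != 0 :> R by rewrite pnatr_eq0 -lt0n bin_gt0.
  have x0 : (i`! * (n - i)`!)%:R != 0 :> R.
    by rewrite pnatr_eq0 -lt0n muln_gt0 !fact_gt0.
  have h1 : h ^+ n != 0 by rewrite expf_neq0 ?gt_eqF.
  rewrite e; move: (_%:R) (_%:R) c0 x0 (h ^+ n) h1 => c X c0 X0 H H0.
  by field; rewrite c0 X0.
have -> : delta / h = n%:R / 8 by rewrite /h; field; rewrite !gt_eqF.
rewrite mulrAC ltr_pdivrMr// mul1r natrX -exprMn.
have -> : n%:R / 8 * 2 = n%:R / 4 :> R by field.
have := expnn_lt_fact n0; rewrite -(ltr_nat R) natrM !natrX.
by rewrite expr_div_n ltr_pdivrMr ?exprn_gt0// mulrC.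
Qed.
End polya.

(** * Area of the sublevel sets of a defining polynomial *)

Section sublevel_area.
Variable R : realType.
Local Notation plane := (measurableTypeR R * measurableTypeR R)%type.
Local Notation toC := (@to_complex R).
Local Notation D1 := (toC @^-1` disk 1).
Implicit Types (p P : {poly R[i]}) (Q : {poly {poly R[i]}}) (W : set R[i]).

(** |p(x + iy)|^2 as a polynomial in the real variable y: the second factor is the
    conjugate of the first for real y. *)
Definition line_sqr_norm (x : R) p : {poly R[i]} :=
  (p \Po (x%:C%:P + 'i%C *: 'X)) * (conj_poly p \Po (x%:C%:P - 'i%C *: 'X)).

Lemma line_sqr_norm_horner x p (y : R) :
  (line_sqr_norm x p).[y%:C] = (poly_sqr_norm p).[x +i* y, (x +i* y)^*%R].
Proof.
rewrite poly_sqr_norm_horner2 /line_sqr_norm hornerM !horner_comp !hornerE.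
have -> : x%:C + 'i%C * y%:C = x +i* y by simpc.
by have -> : x%:C - 'i%C * y%:C = (x +i* y)^*%R by simpc.
Qed.

Lemma i_neq0 : 'i%C != 0 :> R[i].
Proof. by rewrite eq_complex/= oner_eq0 andbF. Qed.

Lemma size_affine (c b : R[i]) : b != 0 -> size (c%:P + b *: 'X) = 2%N.
Proof.
move=> b0; rewrite addrC size_polyDl ?size_scale ?size_polyX//.
by rewrite (leq_ltn_trans (size_polyC_leq1 _)).
Qed.

Lemma lead_coef_affine (c b : R[i]) : b != 0 -> lead_coef (c%:P + b *: 'X) = b.
Proof.
move=> b0; rewrite addrC lead_coefDl ?lead_coefZ ?lead_coefX ?mulr1//.
by rewrite size_scale// size_polyX (leq_ltn_trans (size_polyC_leq1 _)).
Qed.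

Lemma size_line_sqr_norm x p : p != 0 ->
  size (line_sqr_norm x p) = (size p + size p).-1.
Proof.
move=> p0; have i0 := i_neq0; have ni0 : - 'i%C != 0 :> R[i] by rewrite oppr_eq0.
have s1 : size (p \Po (x%:C%:P + 'i%C *: 'X)) = size p.
  by rewrite size_comp_poly2// size_affine.
have s2 : size (conj_poly p \Po (x%:C%:P - 'i%C *: 'X)) = size p.
  by rewrite size_comp_poly2 ?size_conj_poly// -scaleNr size_affine.
by rewrite size_mul ?s1 ?s2// -size_poly_gt0 ?s1 ?s2 size_poly_gt0.
Qed.

Lemma monic_line_sqr_norm x p : p \is monic -> line_sqr_norm x p \is monic.
Proof.
move=> pm; have i0 := i_neq0; have ni0 : - 'i%C != 0 :> R[i] by rewrite oppr_eq0.
rewrite monicE lead_coefM !lead_coef_comp; try by rewrite -?scaleNr size_affine.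
rewrite -scaleNr !lead_coef_affine// size_conj_poly (monicP pm).
have -> : lead_coef (conj_poly p) = 1.
  by rewrite lead_coefE size_conj_poly coef_conj_poly -lead_coefE (monicP pm) rmorph1.
rewrite !mul1r -exprMn mulrN -expr2 sqr_i opprK expr1n//.
Qed.

(** Along a vertical line the term |P|^2 contributes y^(2d) and the other squares have
    smaller degree in y. *)
Lemma defining_polynomial_line d (a : d.-tuple R[i]) W Q (x : R) :
  defining_polynomial (\prod_(x <- a) ('X - x%:P)) W Q ->
  exists f : {poly R[i]}, [/\ f \is monic, size f = (2 * d).+1 &
    forall y : R, f.[y%:C] = polarized Q (x +i* y) (x +i* y)].
Proof.
rewrite /defining_polynomial size_prod_XsubC size_tuple/=.
set P := \prod_(x <- a) _; move=> [_ [p [sp pd ->]] _ _].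
have Pm : p d \is monic by rewrite pd; apply: monic_prod_XsubC.
have szP : size (line_sqr_norm x (p d)) = (2 * d).+1.
  by rewrite size_line_sqr_norm ?monic_neq0// sp// addSn addnS mul2n addnn.
have szS : (size (- \sum_(j < d) line_sqr_norm x (p j)) < (2 * d).+1)%N.
  rewrite size_polyN ltnS (leq_trans (size_sum _ _ _))//; apply/bigmax_leqP => j _.
  have sj := sp j (ltnW (ltn_ord j)).
  rewrite size_line_sqr_norm -?size_poly_gt0 ?sj//.
  by have := ltn_ord j; lia.
exists (line_sqr_norm x (p d) - \sum_(j < d) line_sqr_norm x (p j)); split.
- by rewrite monicE lead_coefDl ?szP// -monicE monic_line_sqr_norm.
- by rewrite size_polyDl ?szP.
- move=> y; rewrite /polarized hornerD hornerN horner_sum line_sqr_norm_horner.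
  rewrite hornerD hornerN horner_sum hornerD hornerN horner_sum; congr (_ - _).
  by apply: eq_bigr => j _; rewrite line_sqr_norm_horner.
Qed.

Lemma cmeasurable_polarized Q : cmeasurable (fun u => polarized Q u u).
Proof.
apply: cmeasurable_horner2; first exact: cmeasurable_id.
by apply: cmeasurableJ; exact: cmeasurable_id.
Qed.

Definition sublevel Q (e : R) : set plane :=
  D1 `&` [set p | normc (polarized Q (toC p) (toC p)) <= e].

Lemma measurable_sublevel Q e : measurable (sublevel Q e).
Proof.
apply: measurableI; first exact: measurable_disk.
have -> : [set p | normc (polarized Q (toC p) (toC p)) <= e] =
    setT `&` (fun p : plane => normc (polarized Q (toC p) (toC p))) @^-1` `]-oo, e]%classic.
  by rewrite setTI; apply/seteqP; split=> p; rewrite /= in_itv.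
exact: (cmeasurable_norm (cmeasurable_polarized Q)).
Qed.

(** The product measure is by definition the integral of the measures of the
    vertical slices; each slice obeys Polya's bound and only abscissae in [-1, 1]
    contribute. *)
Lemma sublevel_area d (a : d.-tuple R[i]) W Q (delta : R) :
  (0 < d)%N -> 0 < delta ->
  defining_polynomial (\prod_(x <- a) ('X - x%:P)) W Q ->
  (area R (sublevel Q (delta ^+ (2 * d))) <= (16 * delta)%:E)%E.
Proof.
move=> d0 delta0 dQ; set B := sublevel _ _.
have mB : measurable B by exact: measurable_sublevel.
pose I : set (measurableTypeR R) := `[(-1), 1]%classic.
have mI : measurable I by exact: measurable_itv.
have Bsub x y : B (x, y) -> I x /\ I y.
  move=> [xy1 _]; have := normc_Re (x +i* y); have := normc_Im (x +i* y).
  move: xy1; rewrite /disk/= => xy1 /le_lt_trans-/(_ _ xy1) y1 /le_lt_trans-/(_ _ xy1) x1.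
  by split; rewrite /I/= in_itv/= -ler_norml ltW.
have slice (x : R) : (lebesgue_measure (xsection B x) <= (8 * delta)%:E * (\1_I x)%:E)%E.
  have [xI|xI] := pselect (I x); last first.
    rewrite (_ : xsection B x = set0); last first.
      by apply/seteqP; split=> y //; rewrite /xsection/= inE => /Bsub[].
    by rewrite measure0 indicE memNset// mule0.
  rewrite indicE mem_set// mule1.
  have [f [fm sf fE]] := defining_polynomial_line x dQ.
  apply: (@polya_sublevel R f (2 * d) delta (-1) 1) => //.
  - by rewrite muln_gt0.
  - exact: measurable_xsection.
  - by move=> y; rewrite /xsection/= inE => /Bsub[].
  - by move=> y; rewrite /xsection/= inE => -[_]; rewrite fE.
have -> : area R B = (\int[lebesgue_measure]_x lebesgue_measure (xsection B x))%E by [].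
apply: (@le_trans _ _ (\int[lebesgue_measure]_(x in [set: R]) ((8 * delta)%:E * (\1_I x)%:E))%E).
  apply: ge0_le_integral => //.
  - exact: measurable_fun_xsection.
  - by apply: measurable_funeM; apply/measurable_EFinP; exact: measurable_indic.
rewrite ge0_integralZl//; last 2 first.
  - by apply/measurable_EFinP; exact: measurable_indic.
  - by rewrite lee_fin mulr_ge0// ltW.
rewrite integral_indic// setIT [X in (_ * X)%E](_ : _ = 2%:E).
  by rewrite -EFinM lee_fin; lra.
by rewrite [LHS]lebesgue_itvcc; [congr EFin; ring|lra].
Qed.

End sublevel_area.

(** * Area of the symmetric difference *)

Section symmetric_difference.
Variable R : realType.
Local Notation plane := (measurableTypeR R * measurableTypeR R)%type.
Local Notation toC := (@to_complex R).
Local Notation D1 := (toC @^-1` disk 1).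
Implicit Types (Q : {poly {poly R[i]}}) (W : set R[i]).

Lemma defining_polynomial_real P W Q u : defining_polynomial P W Q ->
  polarized Q u u = (complex.Re (polarized Q u u))%:C.
Proof.
move=> [_ [p [_ _ ->]] _ _]; set z := polarized _ _ _.
suff : complex.Im z = 0 by case: z => x y /= ->.
have imz (w : R[i]) : complex.Im (w * w^*%R) = 0.
  by case: w => x y; rewrite ImM/=; ring.
rewrite /z /polarized hornerD hornerN hornerD hornerN ImD ImN.
rewrite !poly_sqr_norm_horner2 conj_poly_horner imz.
rewrite add0r horner_sum horner_sum; apply/eqP; rewrite oppr_eq0; apply/eqP.
elim/big_ind: _ => // [v w v0 w0|j _]; first by rewrite ImD v0 w0 addr0.
by rewrite poly_sqr_norm_horner2 conj_poly_horner imz.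
Qed.

Section estimate.
Variables (d : nat) (a : d.-tuple R[i]) (W1 W2 : set R[i]) (Q : {poly {poly R[i]}}).
Hypotheses (d0 : (0 < d)%N)
           (mW1 : measurable (toC @^-1` W1 : set plane))
           (mW2 : measurable (toC @^-1` W2 : set plane))
           (dQ : defining_polynomial (\prod_(x <- a) ('X - x%:P)) W1 Q).

Local Notation chi u := ((\1_W1 u - \1_W2 u)%R : R).
Local Notation q u := (complex.Re (polarized Q u u)).

(** Since Q has opposite signs on the two parts of the symmetric difference, this
    integral measures that set with the weight |Q|; see [abs_q_chi_integral_le]. *)
Definition weighted_difference : R[i] :=
  cintegral (disk 1) (fun u => polarized Q u u * (\1_W1 u - \1_W2 u)).

Lemma measurable_abs_q_chi :
  measurable_fun setT (fun p : plane => `|q (toC p)| * `|chi (toC p)|).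
Proof.
apply: measurable_funM; apply: measurableT_comp => //.
  by have [] := cmeasurable_polarized Q.
exact: measurable_chi.
Qed.

Lemma polarized_bounded : exists2 K : R, 0 <= K &
  forall u, disk 1 u -> normc (polarized Q u u) <= K.
Proof.
have bQ := defining_polynomial_bidegree dQ.
exists (2 ^+ d * 2 ^+ d * wiener2 (bireverse d Q)).
  by rewrite !mulr_ge0 ?exprn_ge0// (rnorm_ge0 (wiener2_norm R)).
move=> u; rewrite /disk/= => /ltW u1; have u2 : normc u <= 2 by rewrite (le_trans u1)// ler1n.
by apply: normc_horner2_le => //; rewrite normc_conj.
Qed.

Lemma abs_q_le K u : normc (polarized Q u u) <= K -> `|q u| * `|chi u| <= K.
Proof.
move=> uK; rewrite (le_trans _ uK)// (le_trans _ (normc_Re _))// ler_piMr//.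
exact: chi_le1.
Qed.

Lemma integrable_abs_q_chi :
  (area R).-integrable D1 (EFin \o (fun p => `|q (toC p)| * `|chi (toC p)|)).
Proof.
have [K K0 QK] := polarized_bounded.
apply: (@bounded_integrable _ _ _ K) => //.
- exact: measurable_disk.
- exact: measurable_abs_q_chi.
- by move=> p Dp; rewrite ger0_norm ?mulr_ge0// abs_q_le// QK.
Qed.

(** A finite set lies on finitely many vertical lines. *)
Lemma finite_null (F : set R[i]) : finite_set F ->
  exists L : set plane, [/\ measurable L, area R L = 0%E & toC @^-1` F `<=` L].
Proof.
move=> finF; pose A : set (measurableTypeR R) := (@complex.Re R) @` F.
have finA : finite_set A by exact: finite_image.
have mA : measurable A.
  have -> : A = \bigcup_(x in A) [set x].
    by apply/seteqP; split=> [x Ax|x [y Ay ->]]//; exists x.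
  apply: (fin_bigcup_measurable finA) => x _.
  have -> : [set x] = `[x, x]%classic by apply/esym; exact: set_itv1.
  exact: measurable_itv.
exists (A `*` setT); split; first exact: measurableX.
  have -> : area R (A `*` setT) = (lebesgue_measure A * lebesgue_measure [set: R])%E.
    exact: product_measure1E.
  by rewrite countable_lebesgue_measure0 ?mul0e//; exact: finite_set_countable.
by move=> [x y] /= Fxy; split=> //; exists (x +i* y).
Qed.

(** [Q] is negative on the first domain and nonnegative off it, up to finitely many
    points, so [Q * chi] has the constant sign of - |Q chi| and there is no
    cancellation in the integral. *)
Lemma abs_q_chi_integral_le :
  \int[area R]_(p in D1) (`|q (toC p)| * `|chi (toC p)|) <= normc weighted_difference.
Proof.
have mD := @measurable_disk R 1.
have -> : \int[area R]_(p in D1) (`|q (toC p)| * `|chi (toC p)|) =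
    - complex.Re weighted_difference; last first.
  by rewrite (le_trans (ler_norm _))// normrN normc_Re.
have eRe u : complex.Re (polarized Q u u * (\1_W1 u - \1_W2 u)) = q u * chi u.
  rewrite (defining_polynomial_real u dQ) !indicE ReM.
  by case: (u \in W1); case: (u \in W2) => /=; ring.
rewrite /weighted_difference /cintegral/=.
under [in RHS]eq_Rintegral do rewrite eRe.
have ic : (area R).-integrable D1 (EFin \o (fun p => q (toC p) * chi (toC p))).
  have [K K0 QK] := polarized_bounded.
  apply: (@bounded_integrable _ _ _ K) => //.
    apply: measurable_funM; last exact: measurable_chi.
    by have [] := cmeasurable_polarized Q.
  by move=> p Dp; rewrite normrM abs_q_le// QK.
(* [L] is a null set outside which [W1] is exactly the set where Q < 0. *)
have [_ _ finF _] := dQ.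
have [L [mL L0 FL]] := finite_null finF.
rewrite -mulN1r -RintegralZl// /Rintegral; congr fine.
rewrite [LHS](negligible_integral mL)//; last exact: integrable_abs_q_chi.
rewrite [RHS](negligible_integral mL)//; last first.
  by have := integrableZl mD (-1) ic; apply: eq_integrable => // p _; rewrite /= EFinM.
apply: eq_integral => p; rewrite inE => -[Dp Lp]; congr EFin.
have ltE : polarized Q (toC p) (toC p) < 0 <-> q (toC p) < 0.
  by rewrite {1}(defining_polynomial_real (toC p) dQ) ltcR.
have WE : W1 (toC p) <-> q (toC p) < 0.
  rewrite -ltE; split=> [W1p|Qp]; apply: contrapT => h; apply: Lp; apply: FL.
    by left; split.
  by right; split.
rewrite !indicE; have [W1p|W1p] := pselect (W1 (toC p)).
  have := WE.1 W1p => q0; rewrite (mem_set W1p) ltr0_norm//.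
  by case: (_ \in W2); rewrite /= ?subrr ?subr0 ?normr0 ?normr1; ring.
have q0 : 0 <= q (toC p) by rewrite leNgt; apply/negP => /WE.2.
rewrite (memNset W1p) ger0_norm//.
by case: (_ \in W2); rewrite /= ?sub0r ?oppr0 ?normrN ?normr0 ?normr1; ring.
Qed.

(** On the sublevel set where |Q| <= delta^(2d) the area is at most 16 delta; elsewhere
    |chi| <= |Q chi| / delta^(2d), whose integral is at most delta. *)
Lemma diff_area_le (delta : R) : 0 < delta ->
  normc weighted_difference <= delta ^+ (2 * d + 1) ->
  diff_area W1 W2 <= 17 * delta.
Proof.
move=> delta0 Idelta; have mD := @measurable_disk R 1.
set e := delta ^+ (2 * d); have e0 : 0 < e by rewrite exprn_gt0.
pose B := sublevel Q e; have mB : measurable B by exact: measurable_sublevel.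
have BD : B `<=` D1 by move=> p [].
have aB : fine (area R B) <= 16 * delta.
  rewrite -lee_fin fineK; first exact: sublevel_area dQ.
  by rewrite ge0_fin_numE// area_sub_disk1_lty.
have iB : (area R).-integrable D1 (EFin \o \1_B).
  apply: (@bounded_integrable _ _ _ 1) => //.
  by move=> p _; rewrite indicE; case: (_ \in _); rewrite ?normr0 ?normr1.
have iJ := integrable_abs_q_chi.
have iZ : (area R).-integrable D1
    (EFin \o (fun p => e^-1 * (`|q (toC p)| * `|chi (toC p)|))).
  by have := integrableZl mD e^-1 iJ; apply: eq_integrable => // p _; rewrite /= EFinM.
have : diff_area W1 W2 <= \int[area R]_(p in D1)
    (\1_B p + e^-1 * (`|q (toC p)| * `|chi (toC p)|)).
  rewrite diff_areaE; apply: le_Rintegral => //.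
  - exact: integrable_chi.
  - by have := integrableD mD iB iZ; apply: eq_integrable.
  - move=> p Dp; rewrite (indicE _ B); have [Bp|Bp] := pselect (B p).
      rewrite (mem_set Bp) (le_trans (chi_le1 _ _ _))// lerDl.
      by rewrite !mulr_ge0// invr_ge0 ltW.
    rewrite (memNset Bp) add0r ler_pdivlMl// ler_wpM2r//.
    rewrite leNgt; apply/negP => qe; apply: Bp; split=> //=.
    by rewrite (defining_polynomial_real (toC p) dQ) normc_real ltW.
rewrite RintegralD// RintegralZl//.
have -> : \int[area R]_(p in D1) \1_B p = fine (area R B).
  rewrite /Rintegral (integral_indic _ mD mB); congr (fine (area R _)).
  exact/setIidPl.
move=> /le_trans; apply.
have -> : 17 * delta = 16 * delta + delta by ring.
apply: lerD => //; rewrite ler_pdivrMl//.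
by rewrite (le_trans abs_q_chi_integral_le)// (le_trans Idelta)// exprD expr1.
Qed.

Lemma diff_area_le_root : diff_area W1 W2 <=
  17 * normc weighted_difference `^ (2 * d + 1)%:R^-1.
Proof.
set rho := _ `^ _; have rho0 : 0 <= rho by exact: powR_ge0.
have rhoX : rho ^+ (2 * d + 1) = normc weighted_difference.
  have n0 : (2 * d + 1)%:R != 0 :> R by rewrite pnatr_eq0 addn1.
  by rewrite -powR_mulrn// -powRrM (mulVf n0) powRr1 ?normc_ge0.
apply/ler_addgt0Pr => e e0.
have e17 : 0 < e / 17 by rewrite divr_gt0.
have := @diff_area_le (rho + e / 17); rewrite ltr_wpDl// => /(_ isT).
rewrite mulrDr (mulrC 17 (e / 17)) divfK//; apply.
by rewrite -rhoX lerXn2r ?nnegrE ?addr_ge0 ?(ltW e17)// lerDl ltW.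
Qed.

End estimate.
End symmetric_difference.

(** * Stability of the defining polynomial under a weighted difference *)

Theorem theorem5p4 (R : realType) :
  exists C : R, 0 < C /\
    forall (d : nat) (a : d.-tuple R[i]) (Omega1 Omega2 : set R[i])
           (P : {poly R[i]}) (Q1 Q2 : {poly {poly R[i]}}),
      quadrature_domain a Omega1 -> Omega1 `<=` disk 1 ->
      quadrature_domain a Omega2 -> Omega2 `<=` disk 1 ->
      P = \prod_(x <- a) ('X - x%:P) ->
      defining_polynomial P Omega1 Q1 ->
      defining_polynomial P Omega2 Q2 ->
      (norm1 (disk 1) (fun u => (\1_Omega1 u - \1_Omega2 u)%R)
         <= (C / (4 * d%:R))%R%:E)%E ->
      (ereal_sup [set (normc (polarized Q1 z z - polarized Q2 z z)%R)%:E
                 | z in disk 2]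
         <= (4 * C * 3 ^+ (2 * d) *
             normc (cintegral (disk 1) (fun u =>
               polarized Q1 u u * (\1_Omega1 u - \1_Omega2 u)))
               `^ (2 * d + 1)%:R^-1)%R%:E)%E.
Proof.
exists (9 * expR 8); split; first by rewrite mulr_gt0 ?expR_gt0.
move=> d a W1 W2 P Q1 Q2 q1 s1 q2 s2 -> d1 d2 _.
have [a0 o1 _ _ _] := q1; have [_ o2 _ _ _] := q2; rewrite size_tuple in a0.
have m1 := measurable_open_preimage o1; have m2 := measurable_open_preimage o2.
apply: ub_ereal_sup => _ [z /ltW z2 <-]; rewrite lee_fin.
rewrite (le_trans (defining_polynomial_stable q1 s1 q2 s2 d1 d2 z2))//.
have := diff_area_le_root a0 m1 m2 d1; rewrite /weighted_difference.
set rho := _ `^ _ => mrho; have rho0 : 0 <= rho by exact: powR_ge0.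
rewrite (_ : 4 * (9 * expR 8) * 3 ^+ (2 * d) * rho =
  3 ^+ (2 * d) * (2 * expR 8 * (18 * rho))); last by ring.
rewrite ler_wpM2l ?exprn_ge0// ler_wpM2l ?mulr_ge0 ?expR_ge0//.
by rewrite (le_trans mrho)// ler_wpM2r// ler_nat.
Qed.
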